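(* There is a surjective continuous map $f\colon I\to I$, $I=[0,1]$, such that: (i) $f$ has exactly one infinite $\omega$-limit set $\tilde\omega$, and $f$ has zero topological entropy; (ii) $f$ is not Li–Yorke chaotic; (iii) the simple set $M(\tilde\omega)$ of the system associated with $\tilde\omega$ has non-empty interior; (iv) the non-degenerate connected components of $M(\tilde\omega)$ can be indexed as $\{G_n\}_{n\in\mathbb Z}$ so that $f(G_n)=G_{n+1}$ for every $n\in\mathbb Z$.
   Context: For $f\in C(I)$ and $x\in I$, the $\omega$-limit set of $x$ is the set of limit points of the sequence $(f^n(x))_{n\ge1}$. $f$ is Li–Yorke chaotic if there is an uncountable $S\subseteq I$ such that any distinct $x,y\in S$ satisfy $\limsup_n|f^n(x)-f^n(y)|>0$ and $\liminf_n|f^n(x)-f^n(y)|=0$. Associated system: if $h(f)=0$ and $\tilde\omega$ is an infinite $\omega$-limit set of $f$, there is a system $\mathcal I(\tilde\omega)=\{J(n,k):n\ge0,\ 0\le k<2^n\}$ of compact intervals such that for each $n$, $J(n,0),\dots,J(n,2^n-1)$ form an orbit of a minimal $f$-periodic interval of period $2^n$ (with $f(J(n,k))=J(n,k+1 \bmod 2^n)$), containing $\tilde\omega$ in their union, and $J(n+1,0)\subset J(n,0)$. The simple set is $M(\tilde\omega)=\bigcap_{n\ge0}\bigcup_{0\le k<2^n}J(n,k)$; it satisfies $f(M(\tilde\omega))=M(\tilde\omega)\supseteq\tilde\omega$. A component is non-degenerate if it is not a single point. *)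

(* Defs.v *)
From Stdlib Require Import Reals Lra Lia ZArith List.
Open Scope R_scope.

Definition inI (x : R) : Prop := 0 <= x <= 1.

Fixpoint fiter (f : R -> R) (n : nat) (x : R) : R :=
  match n with O => x | S m => f (fiter f m x) end.

Definition continuous_on_I (f : R -> R) : Prop :=
  forall x, inI x -> forall eps, 0 < eps -> exists delta, 0 < delta /\
    forall y, inI y -> Rabs (y - x) < delta -> Rabs (f y - f x) < eps.

Definition maps_I_onto_I (f : R -> R) : Prop :=
  (forall x, inI x -> inI (f x)) /\ (forall y, inI y -> exists x, inI x /\ f x = y).

Definition set_eq (S T : R -> Prop) : Prop := forall x, S x <-> T x.
Definition subset (S T : R -> Prop) : Prop := forall x, S x -> T x.
Definition image (f : R -> R) (S : R -> Prop) : R -> Prop :=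
  fun y => exists x, S x /\ f x = y.
Definition cinterval (a b : R) : R -> Prop := fun x => a <= x <= b.

Definition set_infinite (S : R -> Prop) : Prop :=
  ~ exists l : list R, forall y, S y -> In y l.
Definition set_uncountable (S : R -> Prop) : Prop :=
  ~ exists g : R -> nat, forall x y, S x -> S y -> g x = g y -> x = y.

Definition omega (f : R -> R) (x : R) : R -> Prop :=
  fun y => forall eps, 0 < eps -> forall N : nat,
    exists n : nat, (N <= n)%nat /\ (1 <= n)%nat /\ Rabs (fiter f n x - y) < eps.

(* Topological entropy (Bowen, via (n,eps)-separated sets in I).
   h(f) = lim_{eps->0} limsup_n (1/n) log s_n(eps); since these quantities are
   >= 0 and monotone in eps, h(f) = 0 unfolds to the following. *)
Definition separated (f : R -> R) (n : nat) (eps : R) (l : list R) : Prop :=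
  NoDup l /\ (forall x, In x l -> inI x) /\
  (forall x y, In x l -> In y l -> x <> y ->
     exists k : nat, (k < n)%nat /\ Rabs (fiter f k x - fiter f k y) > eps).

Definition zero_entropy (f : R -> R) : Prop :=
  forall eps, 0 < eps -> forall delta, 0 < delta ->
    exists N : nat, forall n : nat, (N <= n)%nat ->
      forall l, separated f n eps l -> INR (length l) <= exp (delta * INR n).

Definition li_yorke_chaotic (f : R -> R) : Prop :=
  exists S : R -> Prop, (forall x, S x -> inI x) /\ set_uncountable S /\
    forall x y, S x -> S y -> x <> y ->
      (exists eps, 0 < eps /\ forall N : nat, exists n : nat, (N <= n)%nat /\
          Rabs (fiter f n x - fiter f n y) > eps) /\
      (forall eps, 0 < eps -> forall N : nat, exists n : nat, (N <= n)%nat /\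
          Rabs (fiter f n x - fiter f n y) < eps).

Definition iter_image (f : R -> R) (i : nat) (S : R -> Prop) : R -> Prop :=
  fun y => exists x, S x /\ fiter f i x = y.

Definition periodic_interval_cover (f : R -> R) (c d : R) (m : nat)
    (W : R -> Prop) : Prop :=
  0 <= c <= d /\ d <= 1 /\
  set_eq (iter_image f m (cinterval c d)) (cinterval c d) /\
  (forall i j, (i < m)%nat -> (j < m)%nat -> i <> j ->
     forall x, iter_image f i (cinterval c d) x ->
               ~ iter_image f j (cinterval c d) x) /\
  (forall x, W x -> exists i, (i < m)%nat /\ iter_image f i (cinterval c d) x).

Definition assoc_system (f : R -> R) (W : R -> Prop) (a b : nat -> nat -> R) : Prop :=
  (forall n k, (k < 2 ^ n)%nat -> 0 <= a n k <= b n k /\ b n k <= 1) /\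
  (forall n k, (k < 2 ^ n)%nat ->
     set_eq (image f (cinterval (a n k) (b n k)))
            (cinterval (a n ((k + 1) mod 2 ^ n)%nat) (b n ((k + 1) mod 2 ^ n)%nat))) /\
  (forall n k k', (k < 2 ^ n)%nat -> (k' < 2 ^ n)%nat -> k <> k' ->
     forall x, cinterval (a n k) (b n k) x -> ~ cinterval (a n k') (b n k') x) /\
  (forall n x, W x -> exists k, (k < 2 ^ n)%nat /\ cinterval (a n k) (b n k) x) /\
  (forall n k, (k < 2 ^ n)%nat -> forall c d,
     subset (cinterval c d) (cinterval (a n k) (b n k)) ->
     periodic_interval_cover f c d (2 ^ n) W ->
     c = a n k /\ d = b n k) /\
  (forall n, subset (cinterval (a (S n) 0%nat) (b (S n) 0%nat))
                    (cinterval (a n 0%nat) (b n 0%nat))).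

Definition simple_set (a b : nat -> nat -> R) : R -> Prop :=
  fun x => forall n : nat, exists k, (k < 2 ^ n)%nat /\ cinterval (a n k) (b n k) x.

Definition nonempty_interior (M : R -> Prop) : Prop :=
  exists u v, u < v /\ forall x, u < x < v -> M x.

Definition convex (C : R -> Prop) : Prop :=
  forall x y z, C x -> C y -> x <= z <= y -> C z.
Definition component (M G : R -> Prop) : Prop :=
  (exists x, G x) /\ convex G /\ subset G M /\
  forall C, convex C -> subset G C -> subset C M -> set_eq C G.
Definition nondegenerate (G : R -> Prop) : Prop :=
  exists x y, G x /\ G y /\ x < y.

Definition simple_set_props (f : R -> R) (M : R -> Prop) : Prop :=
  nonempty_interior M /\
  exists G : Z -> R -> Prop,
    (forall n, component M (G n) /\ nondegenerate (G n)) /\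
    (forall n m, set_eq (G n) (G m) -> n = m) /\
    (forall C, component M C -> nondegenerate C -> exists n, set_eq C (G n)) /\
    (forall n, set_eq (image f (G n)) (G (n + 1)%Z)).

(* Main.v *)
Require Import Defs.
From Stdlib Require Import Reals ZArith List Lra Lia Psatz Classical.
Open Scope R_scope.

(** Write [L_k = [0, ell k]], with [ell k] decreasing from 1 to 1/2, and let
    [emb k] be the increasing affine contraction of [L_(k+1)] onto an interval
    [R_k] at the right end of [L_k], disjoint from [L_(k+1)].  The maps [F k] of
    [L_k] are defined by mutual renormalization: for even [k], [F k] is [emb k]
    on [L_(k+1)] and [F (k+1)] after the inverse of [emb k] on [R_k]; for odd
    [k], it is [emb k] after [F (k+1)] on [L_(k+1)] and the inverse of [emb k] on
    [R_k]; in between it is affine.  The map of the theorem is [f = F 0], and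
    [F k] is the restriction of [f^(2^k)] to [L_k].

    The intervals of period [2^n] are coded by choosing L or R at each of [n]
    levels, and because of the alternation [f] acts on the codes as the addition
    of 1 on negabinary expansions.  A component of the simple set is degenerate
    if R is chosen infinitely often; the others correspond to finite negabinary
    expansions, that is, to the integers, and each is an affine image of
    [[0, 1/2]], at the left end of the periodic intervals that shrink to it.

    An orbit visits each non-degenerate component at most once and afterwards
    passes it only on the right, where the periodic interval of level [n] exceeds
    the component by at most [ell n - 1/2].  So two orbits which enter all levels
    are asymptotic or separated, and have the same omega-limit set.  The gap
    between [L_(k+1)] and [R_k] is expanded, so all other orbits are eventually
    periodic.  The same expansion shows that the number of [(n, e)]-distinguishable
    orbits of [F k] is at most [O(n)] times that of [F (k+1)] for time [n/2 + 1]
    and the same [e], whence zero entropy. *)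

(** * Nested intervals [L_k] and their affine contractions *)

Lemma Rabs_le_bounds (x a : R) : Rabs x <= a -> - a <= x <= a.
Proof. unfold Rabs. destruct Rcase_abs; lra. Qed.

Definition ell (k : nat) : R := (1 + / 2 ^ k) / 2.
(** As [ell k - ell (S k)] is [/ 2 ^ k / 4], a contraction by this ratio fills at most half of the
    space to the right of [L_(k+1)], and a gap remains. *)
Definition scale (k : nat) : R := / 2 ^ k / 8.
Definition emb (k : nat) (x : R) : R := ell k - scale k * ell (S k) + scale k * x.
Definition emb_inv (k : nat) (x : R) : R := (x - emb k 0) / scale k.
Definition inL (k : nat) (x : R) : Prop := 0 <= x <= ell k.

Lemma inv_pow2_bounds (k : nat) : 0 < / 2 ^ k <= 1.
Proof.
  split.
  - apply Rinv_0_lt_compat, pow_lt; lra.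
  - rewrite <- Rinv_1. apply Rinv_le_contravar; [lra|]. apply pow_R1_Rle; lra.
Qed.

Lemma inv_pow2_S (k : nat) : / 2 ^ S k = / 2 ^ k / 2.
Proof. simpl. field. apply pow_nonzero; lra. Qed.

Lemma scale_bounds (k : nat) : 0 < scale k <= / 8.
Proof. pose proof (inv_pow2_bounds k). unfold scale. lra. Qed.

Lemma ell_0 : ell 0 = 1.
Proof. unfold ell; simpl; lra. Qed.

Lemma level_order (k : nat) :
  / 2 < ell (S k) /\ ell (S k) < emb k 0 /\ emb k 0 < ell k /\ ell k <= 1.
Proof.
  pose proof (inv_pow2_bounds k). unfold emb, scale, ell. rewrite inv_pow2_S.
  repeat split; nra.
Qed.

Lemma emb_ell (k : nat) : emb k (ell (S k)) = ell k.
Proof. unfold emb; ring. Qed.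

Lemma emb_sub (k : nat) (x y : R) : emb k x - emb k y = scale k * (x - y).
Proof. unfold emb; ring. Qed.

Lemma emb_invK (k : nat) (x : R) : emb k (emb_inv k x) = x.
Proof. pose proof (scale_bounds k). unfold emb_inv, emb. field. lra. Qed.

Lemma embK (k : nat) (x : R) : emb_inv k (emb k x) = x.
Proof. pose proof (scale_bounds k). unfold emb_inv, emb. field. lra. Qed.

Lemma emb_inj (k : nat) (x y : R) : emb k x = emb k y -> x = y.
Proof. intro H. rewrite <- (embK k x), H. apply embK. Qed.

Lemma emb_le (k : nat) (x y : R) : x <= y -> emb k x <= emb k y.
Proof. intro. pose proof (scale_bounds k). unfold emb. nra. Qed.

Lemma emb_lt (k : nat) (x y : R) : x < y -> emb k x < emb k y.
Proof. intro. pose proof (scale_bounds k). unfold emb. nra. Qed.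

Lemma emb_inL (k : nat) (x : R) : inL (S k) x -> emb k 0 <= emb k x <= ell k.
Proof. intros [H0 H1]. rewrite <- (emb_ell k). split; apply emb_le; assumption. Qed.

Lemma emb_inv_inL (k : nat) (x : R) :
  emb k 0 <= x <= ell k -> inL (S k) (emb_inv k x).
Proof.
  intros [H0 H1]. rewrite <- (emb_invK k x) in H0, H1.
  split; apply Rnot_lt_le; intro H; apply (emb_lt k) in H;
    rewrite ?emb_ell in H; lra.
Qed.

Lemma emb_contract (k : nat) (x y : R) : Rabs (emb k x - emb k y) <= / 8 * Rabs (x - y).
Proof.
  pose proof (scale_bounds k). rewrite emb_sub, Rabs_mult, (Rabs_right (scale k)) by lra.
  pose proof (Rabs_pos (x - y)). nra.
Qed.

Lemma inL_S (k : nat) (x : R) : inL (S k) x -> inL k x.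
Proof. unfold inL. pose proof (level_order k). lra. Qed.

Lemma inL_emb (k : nat) (x : R) : inL (S k) x -> inL k (emb k x).
Proof. intro H. apply emb_inL in H. unfold inL. pose proof (level_order k). lra. Qed.

Lemma inL_0 (k : nat) : inL k 0.
Proof. unfold inL. pose proof (level_order k). lra. Qed.

Lemma inL_ell (k : nat) : inL k (ell k).
Proof. unfold inL. pose proof (level_order k). lra. Qed.

(** * Construction of the maps *)

Definition clamp (a b x : R) : R := Rmax a (Rmin b x).

Lemma clamp_in (a b x : R) : a <= b -> a <= clamp a b x <= b.
Proof. intro. unfold clamp, Rmax, Rmin. repeat destruct Rle_dec; lra. Qed.

Lemma clamp_id (a b x : R) : a <= x <= b -> clamp a b x = x.
Proof. intro. unfold clamp, Rmax, Rmin. repeat destruct Rle_dec; lra. Qed.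

Lemma clamp_lo (a b x : R) : a <= b -> x <= a -> clamp a b x = a.
Proof. intros. unfold clamp, Rmax, Rmin. repeat destruct Rle_dec; lra. Qed.

Lemma clamp_hi (a b x : R) : a <= b -> b <= x -> clamp a b x = b.
Proof. intros. unfold clamp, Rmax, Rmin. repeat destruct Rle_dec; lra. Qed.

Lemma continuity_clamp (a b : R) : continuity (clamp a b).
Proof.
  intros x e He. exists e. split; [exact He|]. intros y [_ Hy].
  simpl in *. unfold R_dist in *. unfold clamp, Rmax, Rmin, Rabs in *.
  repeat destruct Rle_dec; repeat destruct Rcase_abs; lra.
Qed.

(** For either parity, one of [al] and [be] is the identity and the other is [g]. A passage from L
    to R and back therefore applies [g] exactly once, which is the renormalization in [F2_low] and
    [F2_emb]. *)
Definition al (k : nat) (g : R -> R) (y : R) : R := if Nat.even k then y else g y.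
Definition be (k : nat) (g : R -> R) (y : R) : R := if Nat.even k then g y else y.

(* On [L_(k+1)] this is [emb k (al y)], at [emb k y] it is [be y], and it is
   affine on the gap in between; the clamps make it a total continuous
   function that needs no case distinction. *)
Definition step (k : nat) (g : R -> R) (x : R) : R :=
  emb k (al k g (clamp 0 (ell (S k)) x))
  + (be k g 0 - emb k (al k g (ell (S k)))) / (emb k 0 - ell (S k))
    * (clamp (ell (S k)) (emb k 0) x - ell (S k))
  + (be k g (emb_inv k (clamp (emb k 0) (ell k) x)) - be k g 0).

Lemma step_low (k : nat) (g : R -> R) (x : R) :
  x <= ell (S k) -> step k g x = emb k (al k g (clamp 0 (ell (S k)) x)).
Proof.
  intro H. pose proof (level_order k). unfold step.
  rewrite (clamp_lo (ell (S k)) (emb k 0)), (clamp_lo (emb k 0)) by lra.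
  rewrite embK. field. lra.
Qed.

Lemma step_gap (k : nat) (g : R -> R) (x : R) :
  ell (S k) <= x <= emb k 0 ->
  step k g x = emb k (al k g (ell (S k)))
    + (be k g 0 - emb k (al k g (ell (S k)))) / (emb k 0 - ell (S k)) * (x - ell (S k)).
Proof.
  intro H. pose proof (level_order k). unfold step.
  rewrite (clamp_hi 0 (ell (S k))), (clamp_lo (emb k 0)), (clamp_id (ell (S k))) by lra.
  rewrite embK. field. lra.
Qed.

Lemma step_high (k : nat) (g : R -> R) (x : R) :
  emb k 0 <= x -> step k g x = be k g (emb_inv k (clamp (emb k 0) (ell k) x)).
Proof.
  intro H. pose proof (level_order k). unfold step.
  rewrite (clamp_hi 0 (ell (S k))), (clamp_hi (ell (S k))) by lra.
  field. lra.
Qed.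

Lemma al_inL (k : nat) (g : R -> R) (y : R) :
  (forall z, inL (S k) (g z)) -> inL (S k) y -> inL (S k) (al k g y).
Proof. intros Hg Hy. unfold al. destruct Nat.even; auto. Qed.

Lemma be_inL (k : nat) (g : R -> R) (y : R) :
  (forall z, inL (S k) (g z)) -> inL (S k) y -> inL (S k) (be k g y).
Proof. intros Hg Hy. unfold be. destruct Nat.even; auto. Qed.

Lemma trisect (k : nat) (x : R) :
  x <= ell (S k) \/ ell (S k) <= x <= emb k 0 \/ emb k 0 <= x.
Proof. lra. Qed.

(** The weight depends on [x] alone and not on the end values [u], [v]; so the affine pieces of two
    different maps can be compared with the same [t]. *)
Lemma gap_weight (k : nat) (x : R) :
  ell (S k) <= x <= emb k 0 ->
  exists t, 0 <= t <= 1 /\ forall u v,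
    u + (v - u) / (emb k 0 - ell (S k)) * (x - ell (S k)) = (1 - t) * u + t * v.
Proof.
  intro H. pose proof (level_order k).
  exists ((x - ell (S k)) / (emb k 0 - ell (S k))). split.
  - split.
    + apply Rmult_le_pos; [lra|]. apply Rlt_le, Rinv_0_lt_compat; lra.
    + apply Rmult_le_reg_r with (emb k 0 - ell (S k)); [lra|].
      unfold Rdiv. rewrite Rmult_assoc, Rinv_l by lra. lra.
  - intros. field. lra.
Qed.

Lemma step_inL (k : nat) (g : R -> R) (x : R) :
  (forall z, inL (S k) (g z)) -> inL k (step k g x).
Proof.
  intro Hg. pose proof (level_order k).
  destruct (trisect k x) as [H1|[H1|H1]].
  - rewrite step_low by assumption. apply inL_emb, al_inL; auto.
    apply clamp_in; lra.
  - rewrite step_gap by assumption.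
    destruct (gap_weight k x H1) as (t & Ht & Hw). rewrite Hw.
    assert (Ha := inL_emb k _ (al_inL k g _ Hg (inL_ell (S k)))).
    assert (Hb := inL_S k _ (be_inL k g _ Hg (inL_0 (S k)))).
    unfold inL in *. nra.
  - rewrite step_high by assumption. apply inL_S, be_inL; auto.
    apply emb_inv_inL, clamp_in; lra.
Qed.

(** At odd levels [g] enters only through the contraction [emb k]; at even levels it enters only
    through [be], without contraction. On the gap the difference is a convex combination of the
    differences at the ends. *)
Lemma step_close (k : nat) (g h : R -> R) (e : R) :
  0 <= e -> (forall y, Rabs (g y - h y) <= e) ->
  forall x, Rabs (step k g x - step k h x) <= if Nat.even k then e else / 8 * e.
Proof.
  intros He Hgh x.
  assert (Hal : forall y, Rabs (emb k (al k g y) - emb k (al k h y))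
                          <= if Nat.even k then e else / 8 * e).
  { intro y. eapply Rle_trans; [apply emb_contract|]. unfold al.
    destruct Nat.even; [rewrite Rminus_diag, Rabs_R0; lra|].
    specialize (Hgh y). lra. }
  assert (Hbe : forall y, Rabs (be k g y - be k h y)
                          <= if Nat.even k then e else / 8 * e).
  { intro y. unfold be. destruct Nat.even; [apply Hgh|].
    rewrite Rminus_diag, Rabs_R0; lra. }
  destruct (trisect k x) as [H1|[H1|H1]].
  - rewrite !step_low by assumption. apply Hal.
  - rewrite !step_gap by assumption.
    destruct (gap_weight k x H1) as (t & Ht & Hw). rewrite !Hw.
    specialize (Hal (ell (S k))). specialize (Hbe 0).
    apply Rabs_le_bounds in Hal. apply Rabs_le_bounds in Hbe. apply Rabs_le. nra.
  - rewrite !step_high by assumption. apply Hbe.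
Qed.

Lemma continuity_step (k : nat) (g : R -> R) : continuity g -> continuity (step k g).
Proof.
  intro Hg.
  assert (He : continuity (emb k)).
  { intros x. apply derivable_continuous_pt. unfold emb. reg. }
  assert (Hi : continuity (emb_inv k)).
  { intros x. apply derivable_continuous_pt. unfold emb_inv. reg. }
  assert (Ha : continuity (al k g)).
  { unfold al. destruct Nat.even; [apply derivable_continuous, derivable_id | exact Hg]. }
  assert (Hb : continuity (be k g)).
  { unfold be. destruct Nat.even; [exact Hg | apply derivable_continuous, derivable_id]. }
  unfold step.
  apply continuity_plus; [apply continuity_plus|].
  - apply (continuity_comp (clamp 0 (ell (S k))) (fun y => emb k (al k g y))).
    + apply continuity_clamp.
    + apply (continuity_comp (al k g) (emb k)); assumption.
  - apply continuity_mult; [apply continuity_const; intros ? ?; reflexivity|].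
    apply continuity_minus; [apply continuity_clamp|].
    apply continuity_const; intros ? ?; reflexivity.
  - apply continuity_minus; [|apply continuity_const; intros ? ?; reflexivity].
    apply (continuity_comp (clamp (emb k 0) (ell k)) (fun y => be k g (emb_inv k y))).
    + apply continuity_clamp.
    + apply (continuity_comp (emb_inv k) (be k g)); assumption.
Qed.

(** The equation [F k = step k (F (S k))] refers to ever higher levels and has no base case. It is
    truncated after [N] levels, and [F] is the limit. *)
Fixpoint Fapprox (N k : nat) : R -> R :=
  match N with
  | O => fun _ => 0
  | S N' => step k (Fapprox N' (S k))
  end.

Lemma Fapprox_inL (N k : nat) (x : R) : inL k (Fapprox N k x).
Proof.
  revert k x. induction N as [|N IH]; intros k x; simpl.
  - apply inL_0.
  - apply step_inL. intro z. apply IH.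
Qed.

Lemma continuity_Fapprox (N k : nat) : continuity (Fapprox N k).
Proof.
  revert k. induction N as [|N IH]; intros k; simpl.
  - apply continuity_const; intros ? ?; reflexivity.
  - apply continuity_step, IH.
Qed.

(* Even levels do not contract, odd levels do: the factor 2 at even levels
   absorbs this. *)
Lemma Fapprox_cauchy (N N' k : nat) (x : R) :
  Rabs (Fapprox (N + N') k x - Fapprox N k x)
  <= (if Nat.even k then 2 else 1) * / 2 ^ N.
Proof.
  revert k x. induction N as [|N IH]; intros k x.
  - assert (H1 := Fapprox_inL (0 + N') k x). assert (H2 := Fapprox_inL 0 k x).
    pose proof (level_order k). unfold inL in *.
    replace (/ 2 ^ 0) with 1 by (simpl; lra).
    destruct Nat.even; apply Rabs_le; lra.
  - cbn [Nat.add Fapprox]. pose proof (inv_pow2_bounds N).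
    eapply Rle_trans; [eapply step_close; [|intro y; apply IH]|].
    + destruct Nat.even; lra.
    + rewrite inv_pow2_S, Nat.even_succ, <- Nat.negb_even.
      destruct (Nat.even k); simpl; lra.
Qed.

Lemma Fapprox_cauchy_unif (N N' k : nat) (x : R) :
  Rabs (Fapprox (N + N') k x - Fapprox N k x) <= 2 * / 2 ^ N.
Proof.
  eapply Rle_trans; [apply Fapprox_cauchy|]. pose proof (inv_pow2_bounds N).
  destruct Nat.even; lra.
Qed.

Lemma inv_pow2_small (e : R) : 0 < e -> exists N, forall n, (N <= n)%nat -> / 2 ^ n < e.
Proof.
  intro He. destruct (pow_lt_1_zero (/ 2)) with (y := e) as [N HN].
  - rewrite Rabs_right; lra.
  - exact He.
  - exists N. intros n Hn. specialize (HN n Hn).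
    rewrite pow_inv, Rabs_right in HN; [exact HN|].
    pose proof (inv_pow2_bounds n). lra.
Qed.

Lemma Fapprox_Cauchy_crit (k : nat) (x : R) : Cauchy_crit (fun N => Fapprox N k x).
Proof.
  intros e He. destruct (inv_pow2_small (e / 4)) as [N HN]; [lra|].
  exists N. intros n m Hn Hm. unfold R_dist. specialize (HN N (le_n N)).
  assert (H1 := Fapprox_cauchy_unif N (n - N) k x).
  assert (H2 := Fapprox_cauchy_unif N (m - N) k x).
  replace (N + (n - N))%nat with n in H1 by lia.
  replace (N + (m - N))%nat with m in H2 by lia.
  apply Rabs_le_bounds in H1. apply Rabs_le_bounds in H2. apply Rabs_def1; lra.
Qed.

Definition F (k : nat) (x : R) : R := proj1_sig (R_complete _ (Fapprox_Cauchy_crit k x)).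

Lemma F_approx (N k : nat) (x : R) : Rabs (F k x - Fapprox N k x) <= 2 * / 2 ^ N.
Proof.
  unfold F. destruct (R_complete _ _) as [l Hl]; simpl.
  apply Rnot_lt_le. intro H.
  destruct (Hl (Rabs (l - Fapprox N k x) - 2 * / 2 ^ N)) as [m Hm]; [lra|].
  specialize (Hm (N + m)%nat ltac:(lia)). unfold R_dist in Hm.
  assert (H1 := Fapprox_cauchy_unif N m k x).
  assert (H2 := Rabs_triang (l - Fapprox (N + m) k x) (Fapprox (N + m) k x - Fapprox N k x)).
  rewrite Rabs_minus_sym in Hm.
  replace (l - Fapprox (N + m) k x + (Fapprox (N + m) k x - Fapprox N k x))
    with (l - Fapprox N k x) in H2 by ring. lra.
Qed.

Lemma Rabs_small_eq (x y C : R) : (forall N, Rabs (x - y) <= C * / 2 ^ N) -> x = y.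
Proof.
  intro H. apply NNPP. intro Hne.
  assert (Hp : 0 < Rabs (x - y)) by (apply Rabs_pos_lt; lra).
  assert (HC := H 0%nat). simpl in HC.
  destruct (inv_pow2_small (Rabs (x - y) / (2 * C))) as [N HN].
  { apply Rdiv_lt_0_compat; lra. }
  specialize (HN N (le_n N)). specialize (H N).
  apply (Rmult_lt_compat_l (2 * C)) in HN; [|lra].
  replace (2 * C * (Rabs (x - y) / (2 * C))) with (Rabs (x - y)) in HN by (field; lra).
  lra.
Qed.

Lemma F_step (k : nat) (x : R) : F k x = step k (F (S k)) x.
Proof.
  apply Rabs_small_eq with 3. intro N. pose proof (inv_pow2_bounds N).
  assert (H1 := F_approx (S N) k x). cbn [Fapprox] in H1. rewrite inv_pow2_S in H1.
  assert (H2 := step_close k (F (S k)) (Fapprox N (S k)) (2 * / 2 ^ N)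
     ltac:(lra) (F_approx N (S k)) x).
  assert (H3 : Rabs (step k (F (S k)) x - step k (Fapprox N (S k)) x) <= 2 * / 2 ^ N).
  { destruct Nat.even; lra. }
  apply Rabs_le_bounds in H1. apply Rabs_le_bounds in H3. apply Rabs_le. lra.
Qed.

Lemma F_inL (k : nat) (x : R) : inL k (F k x).
Proof.
  unfold inL. split; apply Rnot_lt_le; intro H.
  - destruct (inv_pow2_small (- F k x / 2)) as [N HN]; [lra|].
    specialize (HN N (le_n N)). assert (H1 := F_approx N k x).
    assert (H2 := Fapprox_inL N k x). unfold inL in H2. apply Rabs_le_bounds in H1. lra.
  - destruct (inv_pow2_small ((F k x - ell k) / 2)) as [N HN]; [lra|].
    specialize (HN N (le_n N)). assert (H1 := F_approx N k x).
    assert (H2 := Fapprox_inL N k x). unfold inL in H2. apply Rabs_le_bounds in H1. lra.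
Qed.

Lemma continuity_F (k : nat) : continuity (F k).
Proof.
  intros x e He. destruct (inv_pow2_small (e / 8)) as [N HN]; [lra|].
  specialize (HN N (le_n N)).
  destruct (continuity_Fapprox N k x (e / 2)) as (d & Hd & Hc); [lra|].
  exists d. split; [exact Hd|]. intros y Hy. specialize (Hc y Hy).
  simpl in *. unfold R_dist in *.
  assert (H1 := F_approx N k x). assert (H2 := F_approx N k y).
  apply Rabs_le_bounds in H1. apply Rabs_le_bounds in H2. apply Rabs_def2 in Hc.
  apply Rabs_def1; lra.
Qed.

Lemma F_low (k : nat) (y : R) : inL (S k) y -> F k y = emb k (al k (F (S k)) y).
Proof.
  intros [H0 H1]. rewrite F_step, step_low by assumption. rewrite clamp_id by lra.
  reflexivity.
Qed.

Lemma F_emb (k : nat) (y : R) : inL (S k) y -> F k (emb k y) = be k (F (S k)) y.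
Proof.
  intros H. assert (H1 := emb_inL k y H). rewrite F_step, step_high by lra.
  rewrite clamp_id by lra. now rewrite embK.
Qed.

(** The left end of the gap is sent into [R_k] and the right end into [L_(k+1)], so the affine piece
    stretches the gap over itself, reversing orientation; [s] is the absolute value of its slope. *)
Lemma F_gap (k : nat) : exists s, 1 < s /\ forall x y,
  ell (S k) <= x <= emb k 0 -> ell (S k) <= y <= emb k 0 ->
  Rabs (F k x - F k y) = s * Rabs (x - y).
Proof.
  pose proof (level_order k) as Ho.
  set (p := emb k (al k (F (S k)) (ell (S k)))). set (q := be k (F (S k)) 0).
  assert (Hpq : p - q > emb k 0 - ell (S k)).
  { unfold p, q, al, be. destruct Nat.even.
    - rewrite emb_ell. assert (H := F_inL (S k) 0). unfold inL in H. lra.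
    - assert (H := emb_inL k _ (F_inL (S k) (ell (S k)))). lra. }
  exists ((p - q) / (emb k 0 - ell (S k))).
  assert (Hs : 1 < (p - q) / (emb k 0 - ell (S k))).
  { apply Rmult_lt_reg_r with (emb k 0 - ell (S k)); [lra|].
    unfold Rdiv. rewrite Rmult_assoc, Rinv_l; lra. }
  split; [exact Hs|]. intros x y Hx Hy.
  rewrite !(F_step k), !step_gap by assumption. fold p q.
  rewrite <- (Rabs_right ((p - q) / (emb k 0 - ell (S k)))) at 1 by lra.
  rewrite <- Rabs_mult, <- Rabs_Ropp. f_equal. field. lra.
Qed.

(** * The periodic intervals *)

(** At odd [k] the map [F (k+1)] is applied on the way from L to R, so a point that starts with
    inner index [i] arrives in [R_k] with inner index [i + 1]. If indices change sign at odd levels,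
    the passage from [2 i + 1] to [i + par k] is the negabinary one from [s] to [(s - 1) / (-2)]. *)
Definition par (k : nat) : Z := if Nat.even k then 0%Z else 1%Z.

(* [J n k j] is the [j]-th interval, [j] modulo [2 ^ n], of the cycle of period
   [2 ^ n] of [F k]; [J n 0 j] is the interval [J(n,j)] of the system. *)
Fixpoint J (n k : nat) (j : Z) (x : R) : Prop :=
  match n with
  | O => inL k x
  | S n' => if Z.even j then J n' (S k) (j / 2) x
            else exists y, J n' (S k) (j / 2 + par k) y /\ x = emb k y
  end.

(* The affine parametrization of [J n k j] by [L_(n+k)]. *)
Fixpoint jmap (n k : nat) (j : Z) (y : R) : R :=
  match n with
  | O => y
  | S n' => if Z.even j then jmap n' (S k) (j / 2) y
            else emb k (jmap n' (S k) (j / 2 + par k) y)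
  end.

Definition U (n k : nat) (x : R) : Prop := exists j, J n k j x.

Lemma Z_even_or_odd (j : Z) : exists i, j = (2 * i)%Z \/ j = (2 * i + 1)%Z.
Proof. exists (j / 2)%Z. pose proof (Z.div_mod j 2). pose proof (Z.mod_pos_bound j 2). lia. Qed.

Lemma even_double (i : Z) : Z.even (2 * i) = true.
Proof. rewrite Z.even_mul. reflexivity. Qed.

Lemma even_double_1 (i : Z) : Z.even (2 * i + 1) = false.
Proof. rewrite Z.even_add, Z.even_mul. reflexivity. Qed.

Lemma half_double (i : Z) : (2 * i / 2)%Z = i.
Proof. rewrite Z.mul_comm. apply Z.div_mul. lia. Qed.

Lemma half_double_1 (i : Z) : ((2 * i + 1) / 2)%Z = i.
Proof. symmetry. apply Z.div_unique with 1%Z; lia. Qed.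

Lemma J_even (n k : nat) (i : Z) (x : R) : J (S n) k (2 * i) x = J n (S k) i x.
Proof. cbn [J]. rewrite even_double, half_double. reflexivity. Qed.

Lemma J_odd (n k : nat) (i : Z) (x : R) :
  J (S n) k (2 * i + 1) x = exists y, J n (S k) (i + par k) y /\ x = emb k y.
Proof. cbn [J]. rewrite even_double_1, half_double_1. reflexivity. Qed.

Lemma jmap_even (n k : nat) (i : Z) (y : R) : jmap (S n) k (2 * i) y = jmap n (S k) i y.
Proof. cbn [jmap]. rewrite even_double, half_double. reflexivity. Qed.

Lemma jmap_odd (n k : nat) (i : Z) (y : R) :
  jmap (S n) k (2 * i + 1) y = emb k (jmap n (S k) (i + par k) y).
Proof. cbn [jmap]. rewrite even_double_1, half_double_1. reflexivity. Qed.

Lemma J_inL (n k : nat) (j : Z) (x : R) : J n k j x -> inL k x.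
Proof.
  revert k j x. induction n as [|n IH]; intros k j x; [trivial|].
  destruct (Z_even_or_odd j) as [i [-> | ->]].
  - rewrite J_even. intro H. apply inL_S. eapply IH, H.
  - rewrite J_odd. intros (y & Hy & ->). apply inL_emb. eapply IH, Hy.
Qed.

Lemma jmap_affine (n k : nat) (j : Z) :
  exists s, 0 < s <= 1 /\ forall x y, jmap n k j x - jmap n k j y = s * (x - y).
Proof.
  revert k j. induction n as [|n IH]; intros k j.
  - exists 1. split; [lra|]. intros; simpl; ring.
  - destruct (Z_even_or_odd j) as [i [-> | ->]].
    + destruct (IH (S k) i) as (s & Hs & H). exists s. split; [exact Hs|].
      intros. rewrite !jmap_even. apply H.
    + destruct (IH (S k) (i + par k)%Z) as (s & Hs & H). pose proof (scale_bounds k).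
      exists (scale k * s). split; [nra|].
      intros. rewrite !jmap_odd, emb_sub, H. ring.
Qed.

Lemma jmap_le (n k : nat) (j : Z) (x y : R) : x <= y -> jmap n k j x <= jmap n k j y.
Proof.
  intro. destruct (jmap_affine n k j) as (s & Hs & Hj). specialize (Hj y x). nra.
Qed.

Lemma J_interval (n k : nat) (j : Z) (x : R) :
  J n k j x <-> jmap n k j 0 <= x <= jmap n k j (ell (n + k)).
Proof.
  revert k j x. induction n as [|n IH]; intros k j x; [reflexivity|].
  replace (S n + k)%nat with (n + S k)%nat by lia.
  destruct (Z_even_or_odd j) as [i [-> | ->]].
  - rewrite J_even, !jmap_even. apply IH.
  - rewrite J_odd, !jmap_odd. split.
    + intros (y & Hy & ->). apply IH in Hy. split; apply emb_le; lra.
    + intros [H0 H1]. exists (emb_inv k x). rewrite emb_invK. split; [|reflexivity].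
      apply IH. rewrite <- (emb_invK k x) in H0, H1.
      split; apply Rnot_lt_le; intro H; apply (emb_lt k) in H; lra.
Qed.

Lemma jmap_period (n k : nat) (j m : Z) (y : R) :
  jmap n k (j + m * 2 ^ Z.of_nat n) y = jmap n k j y.
Proof.
  revert k j. induction n as [|n IH]; intros k j; [reflexivity|].
  rewrite Nat2Z.inj_succ, Z.pow_succ_r by lia.
  destruct (Z_even_or_odd j) as [i [-> | ->]].
  - replace (2 * i + m * (2 * 2 ^ Z.of_nat n))%Z
      with (2 * (i + m * 2 ^ Z.of_nat n))%Z by ring.
    rewrite !jmap_even. apply IH.
  - replace (2 * i + 1 + m * (2 * 2 ^ Z.of_nat n))%Z
      with (2 * (i + m * 2 ^ Z.of_nat n) + 1)%Z by ring.
    rewrite !jmap_odd. f_equal. rewrite <- (IH (S k) (i + par k)%Z). f_equal. ring.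
Qed.

Lemma jmap_congr (n k : nat) (j j' : Z) (y : R) :
  (2 ^ Z.of_nat n | j - j')%Z -> jmap n k j y = jmap n k j' y.
Proof.
  intros [m Hm]. replace j with (j' + m * 2 ^ Z.of_nat n)%Z by lia. apply jmap_period.
Qed.

Lemma J_congr (n k : nat) (j j' : Z) (x : R) :
  (2 ^ Z.of_nat n | j - j')%Z -> J n k j x -> J n k j' x.
Proof. intros H. rewrite !J_interval, !(jmap_congr n k j j') by assumption. trivial. Qed.

(** Indices of different parity are kept apart by the gap; for equal parity the distance comes from
    level [S k], possibly multiplied by [scale k]. The uniform distance is what makes orbits distal
    later. *)
Lemma J_separated (n k : nat) :
  exists d, 0 < d /\ forall j j' x x', J n k j x -> J n k j' x' -> Rabs (x - x') < d ->
    (2 ^ Z.of_nat n | j - j')%Z.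
Proof.
  revert k. induction n as [|n IH]; intros k.
  - exists 1. split; [lra|]. intros. apply Z.divide_1_l.
  - destruct (IH (S k)) as (d & Hd & H). pose proof (scale_bounds k) as Hs.
    pose proof (level_order k) as Ho.
    exists (Rmin (emb k 0 - ell (S k)) (scale k * d)). split.
    { apply Rmin_glb_lt; [lra|]. nra. }
    intros j j' x x' Hx Hx' Hd'.
    pose proof (Rmin_l (emb k 0 - ell (S k)) (scale k * d)) as HR1.
    pose proof (Rmin_r (emb k 0 - ell (S k)) (scale k * d)) as HR2.
    set (mn := Rmin _ _) in *. clearbody mn.
    rewrite Nat2Z.inj_succ, Z.pow_succ_r by lia.
    destruct (Z_even_or_odd j) as [i [-> | ->]];
      destruct (Z_even_or_odd j') as [i' [-> | ->]];
      rewrite ?J_even, ?J_odd in Hx; rewrite ?J_even, ?J_odd in Hx'.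
    + replace (2 * i - 2 * i')%Z with (2 * (i - i'))%Z by ring.
      apply Z.mul_divide_mono_l. eapply H; eauto. nra.
    + exfalso. destruct Hx' as (y & Hy & ->). apply J_inL in Hx. apply J_inL in Hy.
      apply emb_inL in Hy. unfold inL in Hx. apply Rabs_def2 in Hd'. lra.
    + exfalso. destruct Hx as (y & Hy & ->). apply J_inL in Hx'. apply J_inL in Hy.
      apply emb_inL in Hy. unfold inL in Hx'. apply Rabs_def2 in Hd'. lra.
    + destruct Hx as (y & Hy & ->). destruct Hx' as (y' & Hy' & ->).
      replace (2 * i + 1 - (2 * i' + 1))%Z
        with (2 * ((i + par k) - (i' + par k)))%Z by ring.
      apply Z.mul_divide_mono_l. eapply H; eauto.
      rewrite emb_sub, Rabs_mult, (Rabs_right (scale k)) in Hd' by lra. nra.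
Qed.

Lemma J_disjoint (n k : nat) (j j' : Z) (x : R) :
  J n k j x -> J n k j' x -> (2 ^ Z.of_nat n | j - j')%Z.
Proof.
  destruct (J_separated n k) as (d & Hd & H). intros H1 H2. eapply H; eauto.
  rewrite Rminus_diag, Rabs_R0. exact Hd.
Qed.

Lemma no_large_pow2_divides (t : Z) : t <> 0%Z -> exists n, ~ (2 ^ Z.of_nat n | t)%Z.
Proof.
  intro Ht. exists (Z.to_nat (Z.abs t)). intro Hd.
  apply Z.divide_abs_r in Hd. apply Z.divide_pos_le in Hd; [|lia].
  rewrite Z2Nat.id in Hd by lia. pose proof (Z.pow_gt_lin_r 2 (Z.abs t)). lia.
Qed.

Lemma J_nested (n k : nat) (j : Z) (x : R) : J (S n) k j x -> J n k j x.
Proof.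
  revert k j x. induction n as [|n IH]; intros k j x H.
  - apply J_inL in H. exact H.
  - destruct (Z_even_or_odd j) as [i [-> | ->]].
    + rewrite J_even in *. auto.
    + rewrite J_odd in *. destruct H as (y & Hy & ->). eauto.
Qed.

Lemma U_S (n k : nat) (x : R) :
  U (S n) k x <-> U n (S k) x \/ exists y, U n (S k) y /\ x = emb k y.
Proof.
  split.
  - intros [j Hj]. destruct (Z_even_or_odd j) as [i [-> | ->]].
    + rewrite J_even in Hj. left. eexists; eauto.
    + rewrite J_odd in Hj. destruct Hj as (y & Hy & ->). right. exists y. split; [|reflexivity].
      eexists; eauto.
  - intros [[i Hi] | (y & [i Hi] & ->)].
    + exists (2 * i)%Z. now rewrite J_even.
    + exists (2 * (i - par k) + 1)%Z. rewrite J_odd. exists y. split; [|reflexivity].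
      now replace (i - par k + par k)%Z with i by ring.
Qed.

Lemma U_inL (n k : nat) (x : R) : U n k x -> inL k x.
Proof. intros [j Hj]. eapply J_inL, Hj. Qed.

(** The union of the intervals is closed; the recursion [U_S] yields the distance without an
    enumeration of the indices. *)
Lemma U_closed (n k : nat) (x : R) :
  ~ U n k x -> exists d, 0 < d /\ forall y, U n k y -> d <= Rabs (x - y).
Proof.
  revert k x. induction n as [|n IH]; intros k x H.
  - assert (Hx : ~ inL k x) by (intro; apply H; exists 0%Z; assumption).
    unfold inL in Hx. exists (if Rlt_dec x 0 then - x else x - ell k).
    assert (x < 0 \/ ell k < x) by lra.
    split; [destruct Rlt_dec; lra|]. intros y [j Hy]. simpl in Hy. unfold inL in Hy.
    unfold Rabs. destruct Rlt_dec, Rcase_abs; lra.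
  - rewrite U_S in H.
    destruct (IH (S k) x) as (d1 & Hd1 & H1); [tauto|].
    destruct (IH (S k) (emb_inv k x)) as (d2 & Hd2 & H2).
    { intro Hu. apply H. right. exists (emb_inv k x). now rewrite emb_invK. }
    pose proof (scale_bounds k).
    exists (Rmin d1 (scale k * d2)). split; [apply Rmin_glb_lt; nra|].
    intros y Hy. rewrite U_S in Hy. destruct Hy as [Hy | (z & Hz & ->)].
    + eapply Rle_trans; [apply Rmin_l|]. auto.
    + eapply Rle_trans; [apply Rmin_r|]. specialize (H2 z Hz).
      rewrite <- (emb_invK k x), emb_sub, Rabs_mult, (Rabs_right (scale k)) by lra. nra.
Qed.

(** The parity of [k] gives one extreme value directly: 0 at the left end of [R_k] for odd [k],
    [ell k] at the right end of [L_(k+1)] for even [k]. The other one is inherited from level [S k],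
    which has the opposite parity. *)
Lemma F_zero_and_ell (k : nat) :
  exists a b, inL k a /\ F k a = 0 /\ inL k b /\ F k b = ell k.
Proof.
  assert (Hodd : forall k, Nat.even k = false -> exists a, inL k a /\ F k a = 0).
  { intros m Hm. exists (emb m 0). split; [apply inL_emb, inL_0|].
    rewrite F_emb by apply inL_0. unfold be. now rewrite Hm. }
  assert (Heven : forall k, Nat.even k = true -> exists b, inL k b /\ F k b = ell k).
  { intros m Hm. exists (ell (S m)). split; [apply inL_S, inL_ell|].
    rewrite F_low by apply inL_ell. unfold al. rewrite Hm. apply emb_ell. }
  destruct (Nat.even k) eqn:Hk.
  - destruct (Hodd (S k)) as (a & Ha & Ha').
    { rewrite Nat.even_succ, <- Nat.negb_even, Hk. reflexivity. }
    destruct (Heven k Hk) as (b & Hb). exists (emb k a), b. split; [apply inL_emb, Ha|].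
    split; [|exact Hb]. rewrite F_emb by assumption. unfold be. now rewrite Hk.
  - destruct (Heven (S k)) as (b & Hb & Hb').
    { rewrite Nat.even_succ, <- Nat.negb_even, Hk. reflexivity. }
    destruct (Hodd k Hk) as (a & Ha & Ha'). exists a, b.
    split; [exact Ha|]. split; [exact Ha'|]. split; [apply inL_S, Hb|].
    rewrite F_low by assumption. unfold al. rewrite Hk, Hb'. apply emb_ell.
Qed.

Lemma intermediate_value (g : R -> R) (a b y : R) :
  continuity g -> g a <= y <= g b ->
  exists x, Rmin a b <= x <= Rmax a b /\ g x = y.
Proof.
  intros Hg Hy.
  assert (Hc : continuity (fun x => g x - y)).
  { apply continuity_minus; [exact Hg|]. apply continuity_const; intros ? ?; reflexivity. }
  destruct (Rle_dec a b) as [Hab|Hab].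
  - destruct (IVT_cor (fun x => g x - y) a b Hc Hab) as (z & Hz & Hz'); [nra|].
    exists z. rewrite Rmin_left, Rmax_right by lra. split; [exact Hz | lra].
  - destruct (IVT_cor (fun x => g x - y) b a Hc ltac:(lra)) as (z & Hz & Hz'); [nra|].
    exists z. rewrite Rmin_right, Rmax_left by lra. split; [exact Hz | lra].
Qed.

Lemma F_onto (k : nat) (y : R) : inL k y -> exists x, inL k x /\ F k x = y.
Proof.
  intro Hy. destruct (F_zero_and_ell k) as (a & b & Ha & Ha' & Hb & Hb').
  destruct (intermediate_value (F k) a b y (continuity_F k)) as (x & Hx & Hx').
  { unfold inL in Hy. lra. }
  exists x. split; [|exact Hx']. unfold inL in *. revert Hx.
  unfold Rmin, Rmax. destruct Rle_dec; lra.
Qed.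

Lemma par_cases (k : nat) :
  (Nat.even k = true /\ par k = 0%Z) \/ (Nat.even k = false /\ par k = 1%Z).
Proof. unfold par. destruct Nat.even; auto. Qed.

Lemma F_J (n k : nat) (j : Z) (x : R) : J n k j x -> J n k (j + 1) (F k x).
Proof.
  revert k j x. induction n as [|n IH]; intros k j x H.
  - apply F_inL.
  - destruct (Z_even_or_odd j) as [i [-> | ->]].
    + rewrite J_even in H. rewrite J_odd, F_low by (eapply J_inL, H).
      eexists. split; [|reflexivity]. unfold al.
      destruct (par_cases k) as [[-> ->]|[-> ->]]; rewrite ?Z.add_0_r; auto.
    + rewrite J_odd in H. destruct H as (y & Hy & ->).
      rewrite F_emb by (eapply J_inL, Hy).
      replace (2 * i + 1 + 1)%Z with (2 * (i + 1))%Z by ring. rewrite J_even. unfold be.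
      destruct (par_cases k) as [[-> Hp]|[-> Hp]]; rewrite Hp, ?Z.add_0_r in Hy; auto.
Qed.

Lemma F_J_onto (n k : nat) (j : Z) (y : R) :
  J n k (j + 1) y -> exists x, J n k j x /\ F k x = y.
Proof.
  revert k j y. induction n as [|n IH]; intros k j y H.
  - apply F_onto, H.
  - destruct (Z_even_or_odd j) as [i [-> | ->]].
    + rewrite J_odd in H. destruct H as (z & Hz & ->).
      destruct (par_cases k) as [[Hk Hp]|[Hk Hp]]; rewrite Hp, ?Z.add_0_r in Hz.
      * exists z. rewrite J_even. split; [exact Hz|]. rewrite F_low by (eapply J_inL, Hz).
        unfold al. now rewrite Hk.
      * apply IH in Hz. destruct Hz as (x & Hx & <-). exists x. rewrite J_even.
        split; [exact Hx|]. rewrite F_low by (eapply J_inL, Hx). unfold al. now rewrite Hk.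
    + replace (2 * i + 1 + 1)%Z with (2 * (i + 1))%Z in H by ring. rewrite J_even in H.
      destruct (par_cases k) as [[Hk Hp]|[Hk Hp]].
      * apply IH in H. destruct H as (x & Hx & <-). exists (emb k x).
        rewrite J_odd, Hp, Z.add_0_r. split; [eauto|].
        rewrite F_emb by (eapply J_inL, Hx). unfold be. now rewrite Hk.
      * exists (emb k y). rewrite J_odd, Hp. split; [eauto|].
        rewrite F_emb by (eapply J_inL, H). unfold be. now rewrite Hk.
Qed.

(** * Iterates and renormalization *)

Lemma fiter_add (f : R -> R) (m n : nat) (x : R) :
  fiter f (m + n) x = fiter f m (fiter f n x).
Proof. induction m as [|m IH]; simpl; congruence. Qed.

Lemma fiter_S_r (f : R -> R) (n : nat) (x : R) : fiter f (S n) x = fiter f n (f x).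
Proof. replace (S n) with (n + 1)%nat by lia. apply fiter_add. Qed.

Lemma fiter_J (n k t : nat) (j : Z) (x : R) :
  J n k j x -> J n k (j + Z.of_nat t) (fiter (F k) t x).
Proof.
  intro H. induction t as [|t IH].
  - now rewrite Z.add_0_r.
  - replace (j + Z.of_nat (S t))%Z with (j + Z.of_nat t + 1)%Z by lia. apply F_J, IH.
Qed.

Lemma fiter_J_onto (n k t : nat) (j : Z) (y : R) :
  J n k (j + Z.of_nat t) y -> exists x, J n k j x /\ fiter (F k) t x = y.
Proof.
  revert y. induction t as [|t IH]; intros y H.
  - exists y. rewrite Z.add_0_r in H. auto.
  - replace (j + Z.of_nat (S t))%Z with (j + Z.of_nat t + 1)%Z in H by lia.
    apply F_J_onto in H. destruct H as (z & Hz & <-).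
    destruct (IH z Hz) as (x & Hx & <-). exists x. auto.
Qed.

Lemma fiter_inL (k t : nat) (x : R) : inL k x -> inL k (fiter (F k) t x).
Proof. intro H. destruct t; [exact H|]. apply F_inL. Qed.

Lemma fiter_U (n k t : nat) (x : R) : U n k x -> U n k (fiter (F k) t x).
Proof. intros [j Hj]. eexists. apply fiter_J, Hj. Qed.

Lemma F2_low (k : nat) (x : R) : inL (S k) x -> F k (F k x) = F (S k) x.
Proof.
  intro H. rewrite (F_low k x H), F_emb.
  - unfold al, be. destruct Nat.even; reflexivity.
  - apply al_inL; [apply F_inL | exact H].
Qed.

Lemma F2_emb (k : nat) (x : R) : inL (S k) x -> F k (F k (emb k x)) = emb k (F (S k) x).
Proof.
  intro H. rewrite (F_emb k x H), F_low.
  - unfold al, be. destruct Nat.even; reflexivity.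
  - apply be_inL; [apply F_inL | exact H].
Qed.

Lemma fiter_double_low (k t : nat) (x : R) :
  inL (S k) x -> fiter (F k) (2 * t) x = fiter (F (S k)) t x.
Proof.
  intro H. induction t as [|t IH]; [reflexivity|].
  replace (2 * S t)%nat with (S (S (2 * t))) by lia. cbn [fiter].
  rewrite IH. apply F2_low, fiter_inL, H.
Qed.

Lemma fiter_double_emb (k t : nat) (x : R) :
  inL (S k) x -> fiter (F k) (2 * t) (emb k x) = emb k (fiter (F (S k)) t x).
Proof.
  intro H. induction t as [|t IH]; [reflexivity|].
  replace (2 * S t)%nat with (S (S (2 * t))) by lia. cbn [fiter].
  rewrite IH. apply F2_emb, fiter_inL, H.
Qed.

Lemma fiter_pow2 (n k : nat) (x : R) :
  inL (n + k) x -> fiter (F k) (2 ^ n) x = F (n + k) x.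
Proof.
  revert k. induction n as [|n IH]; intros k H; [reflexivity|].
  replace (S n + k)%nat with (n + S k)%nat in * by lia.
  rewrite Nat.pow_succ_r', fiter_double_low, IH; auto.
  (* What remains is that [L_(n + S k)] is contained in [L_(S k)]. *)
  clear IH. revert H. generalize (S k) as m. intro m. induction n as [|n IH]; [trivial|].
  intro H. apply IH, inL_S, H.
Qed.

Lemma visit (n : nat) (i j : Z) (T : nat) :
  exists t, (T <= t)%nat /\ (2 ^ Z.of_nat n | i + Z.of_nat t - j)%Z.
Proof.
  assert (Hp : (0 < 2 ^ Z.of_nat n)%Z) by (apply Z.pow_pos_nonneg; lia).
  exists (T + Z.to_nat ((j - i - Z.of_nat T) mod 2 ^ Z.of_nat n))%nat. split; [lia|].
  pose proof (Z.mod_pos_bound (j - i - Z.of_nat T) _ Hp).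
  rewrite Nat2Z.inj_add, Z2Nat.id by lia.
  exists (- ((j - i - Z.of_nat T) / 2 ^ Z.of_nat n))%Z.
  pose proof (Z.div_mod (j - i - Z.of_nat T) (2 ^ Z.of_nat n)). lia.
Qed.

Lemma fiter_visits (n k : nat) (x : R) (j : Z) (T : nat) :
  U n k x -> exists t, (T <= t)%nat /\ J n k j (fiter (F k) t x).
Proof.
  intros [i Hi]. destruct (visit n i j T) as (t & Ht & Hd). exists t. split; [exact Ht|].
  eapply J_congr; [exact Hd|]. apply fiter_J, Hi.
Qed.

(** * Orbits that approach the simple set *)

(* Padding the negabinary expansion of [j] by zeros gives an integer [c]. *)
Lemma jmap_representative (n k : nat) (j : Z) :
  exists c, forall m y, jmap (m + n) k c y = jmap n k j y.
Proof.
  revert k j. induction n as [|n IH]; intros k j.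
  - exists 0%Z. intros m y. rewrite Nat.add_0_r. revert k.
    induction m as [|m IH]; intro k; [reflexivity|]. apply (IH (S k)).
  - destruct (Z_even_or_odd j) as [i [-> | ->]].
    + destruct (IH (S k) i) as [c Hc]. exists (2 * c)%Z. intros m y.
      rewrite Nat.add_succ_r, !jmap_even. apply Hc.
    + destruct (IH (S k) (i + par k)%Z) as [c Hc]. exists (2 * (c - par k) + 1)%Z.
      intros m y. rewrite Nat.add_succ_r, !jmap_odd.
      replace (c - par k + par k)%Z with c by ring. now rewrite Hc.
Qed.

(** The affine copy of [[0, 1/2]], the intersection of all [L_m]. It is the non-degenerate component
    whose code continues that of [J n k j] by L forever. *)
Definition core (n k : nat) (j : Z) (x : R) : Prop :=
  jmap n k j 0 <= x <= jmap n k j (/ 2).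

Lemma half_lt_ell (k : nat) : / 2 < ell k.
Proof. pose proof (level_order k). lra. Qed.

Lemma core_sub_J (n k : nat) (j : Z) (x : R) : core n k j x -> J n k j x.
Proof.
  intro H. apply J_interval. unfold core in H.
  pose proof (jmap_le n k j (/ 2) (ell (n + k)) (Rlt_le _ _ (half_lt_ell _))). lra.
Qed.

(** With the padded index [c], the core lies in [J (m + n) k c] for every [m]. A return time is thus
    divisible by arbitrarily large powers of 2. *)
Lemma core_no_return (n k t : nat) (j : Z) (x : R) :
  core n k j x -> core n k j (fiter (F k) t x) -> t = 0%nat.
Proof.
  intros H H'. destruct (jmap_representative n k j) as [c Hc].
  apply NNPP. intro Ht.
  destruct (no_large_pow2_divides (Z.of_nat t)) as [m Hm]; [lia|]. apply Hm.
  assert (Hin : forall z, core n k j z -> J (m + n) k c z).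
  { intros z Hz. apply core_sub_J. unfold core. now rewrite !Hc. }
  assert (Hd := J_disjoint _ _ _ _ _ (fiter_J _ _ t _ _ (Hin _ H)) (Hin _ H')).
  replace (c + Z.of_nat t - c)%Z with (Z.of_nat t) in Hd by ring.
  eapply Z.divide_trans; [|exact Hd]. rewrite Nat2Z.inj_add, Z.pow_add_r by lia.
  apply Z.divide_factor_l.
Qed.

Lemma eventually_outside_core (n k : nat) (j : Z) (x : R) :
  exists T, forall t, (T <= t)%nat -> ~ core n k j (fiter (F k) t x).
Proof.
  destruct (classic (exists t, core n k j (fiter (F k) t x))) as [[t0 H0]|H].
  - exists (S t0). intros t Ht H. replace t with ((t - t0) + t0)%nat in H by lia.
    rewrite fiter_add in H. apply core_no_return in H; [lia | exact H0].
  - exists 0%nat. intros t _ Ht. apply H. now exists t.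
Qed.

Lemma eventually_outside_cores (n k : nat) (x : R) :
  exists T, forall t j, (T <= t)%nat -> ~ core n k j (fiter (F k) t x).
Proof.
  assert (H : forall m, exists T, forall t i, (T <= t)%nat -> (i < m)%nat ->
                ~ core n k (Z.of_nat i) (fiter (F k) t x)).
  { induction m as [|m [T1 H1]]; [exists 0%nat; intros; lia|].
    destruct (eventually_outside_core n k (Z.of_nat m) x) as [T2 H2].
    exists (T1 + T2)%nat. intros t i Ht Hi. destruct (Nat.eq_dec i m) as [->|Hne].
    - apply H2. lia.
    - apply H1; lia. }
  destruct (H (2 ^ n)%nat) as [T HT]. exists T. intros t j Ht.
  assert (Hp : (0 < 2 ^ Z.of_nat n)%Z) by (apply Z.pow_pos_nonneg; lia).
  pose proof (Z.mod_pos_bound j _ Hp) as Hb.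
  specialize (HT t (Z.to_nat (j mod 2 ^ Z.of_nat n)) Ht).
  rewrite Z2Nat.id in HT by lia. unfold core in *.
  rewrite !(jmap_congr n k j (j mod 2 ^ Z.of_nat n)).
  - apply HT. apply Nat2Z.inj_lt. rewrite Z2Nat.id, Nat2Z.inj_pow by lia. simpl. lia.
  - exists (j / 2 ^ Z.of_nat n)%Z. pose proof (Z.div_mod j (2 ^ Z.of_nat n)). lia.
  - exists (j / 2 ^ Z.of_nat n)%Z. pose proof (Z.div_mod j (2 ^ Z.of_nat n)). lia.
Qed.

(** Only the part to the right of the core is left, which is the image of an interval of length
    [ell (n + k) - / 2] under a map of slope at most 1. *)
Lemma outside_core_close (n k : nat) (j : Z) (x y : R) :
  J n k j x -> J n k j y -> ~ core n k j x -> ~ core n k j y ->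
  Rabs (x - y) <= ell (n + k) - / 2.
Proof.
  rewrite !J_interval. unfold core. intros Hx Hy Hcx Hcy.
  destruct (jmap_affine n k j) as (s & Hs & Ha). specialize (Ha (ell (n + k)) (/ 2)).
  pose proof (half_lt_ell (n + k)).
  assert (s * (ell (n + k) - / 2) <= 1 * (ell (n + k) - / 2))
    by (apply Rmult_le_compat_r; lra).
  apply Rabs_le. lra.
Qed.

Lemma ell_small (e : R) : 0 < e -> exists n, ell n - / 2 < e.
Proof.
  intro He. destruct (inv_pow2_small e He) as [n Hn]. exists n.
  specialize (Hn n (le_n n)). unfold ell. lra.
Qed.

(** * Orbits that do not enter all levels *)

Definition LR (k : nat) (x : R) : Prop := x <= ell (S k) \/ emb k 0 <= x.

(** While the orbit stays in the gap, the distance between successive iterates is multiplied by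
    [s > 1]; it stays bounded only if it is 0. *)
Lemma gap_exit (k : nat) (x : R) :
  inL k x -> (exists t, LR k (fiter (F k) t x)) \/ F k x = x.
Proof.
  intro Hx. destruct (classic (exists t, LR k (fiter (F k) t x))) as [H|H]; [now left|right].
  assert (Hg : forall t, ell (S k) <= fiter (F k) t x <= emb k 0).
  { intro t. apply NNPP. intro Hn. apply H. exists t. unfold LR. lra. }
  destruct (F_gap k) as (s & Hs & HF).
  assert (Hgrow : forall t, Rabs (fiter (F k) (S t) x - fiter (F k) t x)
                            = s ^ t * Rabs (F k x - x)).
  { induction t as [|t IH]; [simpl; ring|].
    cbn [fiter]. rewrite HF by apply (Hg (S t)) || apply Hg.
    cbn [fiter] in IH. rewrite IH. simpl. ring. }
  apply NNPP. intro Hne.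
  assert (Hp : 0 < Rabs (F k x - x)) by (apply Rabs_pos_lt; lra).
  (* At this power the distance of successive iterates is at least 2, more than the length of
     [L_k]. *)
  destruct (Pow_x_infinity s) with (b := 2 / Rabs (F k x - x)) as [N HN].
  { rewrite Rabs_right; lra. }
  specialize (HN N (le_n N)). specialize (Hgrow N).
  rewrite Rabs_right in HN by (apply Rle_ge, pow_le; lra).
  apply Rge_le, (Rmult_le_compat_r (Rabs (F k x - x))) in HN; [|lra].
  unfold Rdiv in HN. rewrite Rmult_assoc, Rinv_l, <- Hgrow in HN by lra.
  assert (H1 := fiter_inL k (S N) x Hx). assert (H2 := fiter_inL k N x Hx).
  pose proof (level_order k). unfold inL in *.
  revert HN. unfold Rabs. destruct Rcase_abs; lra.
Qed.

Definition eventually_periodic (f : R -> R) (x : R) : Prop :=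
  exists t p, (1 <= p)%nat /\ fiter f (t + p) x = fiter f t x.

Lemma eventually_periodic_fiter (f : R -> R) (s : nat) (x : R) :
  eventually_periodic f (fiter f s x) -> eventually_periodic f x.
Proof.
  intros (t & p & Hp & H). exists (t + s)%nat, p. split; [exact Hp|].
  rewrite <- !fiter_add in H. rewrite <- H. f_equal. lia.
Qed.

(** An orbit that is not caught at the fixed point of the gap reaches [L_(k+1)], where every second
    iterate follows [F (k+1)]; the induction applies to that map. *)
Lemma enters_or_periodic (n k : nat) (x : R) :
  inL k x -> (exists t, U n k (fiter (F k) t x)) \/ eventually_periodic (F k) x.
Proof.
  revert k x. induction n as [|n IH]; intros k x Hx.
  - left. exists 0%nat, 0%Z. exact Hx.
  - assert (Hlow : forall y, inL (S k) y ->
      (exists t, U (S n) k (fiter (F k) t y)) \/ eventually_periodic (F k) y).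
    { intros y Hy. destruct (IH (S k) y Hy) as [[t Ht] | (t & p & Hp & Ht)].
      - left. exists (2 * t)%nat. rewrite fiter_double_low by assumption.
        apply U_S. now left.
      - right. exists (2 * t)%nat, (2 * p)%nat. split; [lia|].
        rewrite <- Nat.mul_add_distr_l, !fiter_double_low; assumption. }
    assert (Hback : forall s, (exists t, U (S n) k (fiter (F k) t (fiter (F k) s x))) \/
        eventually_periodic (F k) (fiter (F k) s x) ->
        (exists t, U (S n) k (fiter (F k) t x)) \/ eventually_periodic (F k) x).
    { intros s [[t Ht]|Hp].
      - left. exists (t + s)%nat. now rewrite fiter_add.
      - right. eapply eventually_periodic_fiter, Hp. }
    destruct (gap_exit k x Hx) as [[s [Hs|Hs]] | Hfix].
    + apply (Hback s), Hlow. assert (H := fiter_inL k s x Hx). unfold inL in *. lra.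
    (* One more iterate takes a point of [R_k] into [L_(k+1)]. *)
    + apply (Hback (S s)), Hlow. cbn [fiter].
      assert (H := fiter_inL k s x Hx).
      assert (Hy : inL (S k) (emb_inv k (fiter (F k) s x))).
      { apply emb_inv_inL. unfold inL in H. lra. }
      rewrite <- (emb_invK k (fiter (F k) s x)), F_emb by assumption.
      apply be_inL; [apply F_inL | exact Hy].
    + right. exists 0%nat, 1%nat. split; [lia | exact Hfix].
Qed.

(** The points whose orbits enter all levels; the other points of [L_0] are eventually periodic. *)
Definition solenoidal (x : R) : Prop := forall n, exists t, U n 0 (fiter (F 0) t x).

Lemma not_solenoidal_periodic (x : R) :
  inL 0 x -> ~ solenoidal x -> eventually_periodic (F 0) x.
Proof.
  intros Hx H. apply not_all_ex_not in H. destruct H as [n Hn].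
  destruct (enters_or_periodic n 0 x Hx); [contradiction | assumption].
Qed.

Lemma eventually_periodic_iter (f : R -> R) (x : R) (t p q : nat) :
  fiter f (t + p) x = fiter f t x -> fiter f (t + q * p) x = fiter f t x.
Proof.
  intro H. induction q as [|q IH]; [f_equal; lia|].
  replace (t + S q * p)%nat with (q * p + (t + p))%nat by lia.
  rewrite fiter_add, H, <- fiter_add, Nat.add_comm. exact IH.
Qed.

Lemma eventually_periodic_reduce (f : R -> R) (x : R) (t p u : nat) :
  (1 <= p)%nat -> fiter f (t + p) x = fiter f t x -> (t <= u)%nat ->
  exists i, (i < p)%nat /\ fiter f u x = fiter f (t + i) x.
Proof.
  intros Hp H Hu. exists ((u - t) mod p)%nat. split; [apply Nat.mod_upper_bound; lia|].
  pose proof (Nat.div_mod (u - t) p ltac:(lia)) as Hd.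
  rewrite <- (Nat.add_comm ((u - t) mod p)).
  rewrite fiter_add, <- (eventually_periodic_iter f x t p ((u - t) / p) H), <- fiter_add.
  f_equal. lia.
Qed.

Lemma omega_eventually_periodic_finite (f : R -> R) (x : R) :
  eventually_periodic f x -> ~ set_infinite (omega f x).
Proof.
  intros (t & p & Hp & H) Hinf. apply Hinf.
  exists (map (fun i => fiter f i x) (seq 0 (t + p))). intros y Hy.
  apply NNPP. intro Hni.
  assert (Hd : forall l, ~ In y l -> exists d, 0 < d /\ forall z, In z l -> d <= Rabs (z - y)).
  { induction l as [|a l IH]; intro Hl; [exists 1; split; [lra | intros z []]|].
    destruct IH as (d & Hd & Hz); [intro; apply Hl; now right|].
    assert (Ha : 0 < Rabs (a - y)) by (apply Rabs_pos_lt; intro; apply Hl; left; lra).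
    exists (Rmin d (Rabs (a - y))). split; [now apply Rmin_glb_lt|].
    intros z [->|Hin]; [apply Rmin_r|]. eapply Rle_trans; [apply Rmin_l | auto]. }
  destruct (Hd _ Hni) as (d & Hd0 & Hz). destruct (Hy d Hd0 t) as (u & Hu & _ & Hc).
  destruct (eventually_periodic_reduce f x t p u Hp H Hu) as (i & Hi & Hui).
  specialize (Hz (fiter f u x)). apply Rlt_not_le in Hc. apply Hc, Hz.
  apply in_map_iff. exists (t + i)%nat. split; [congruence|]. apply in_seq. lia.
Qed.

Lemma solenoidal_eventually (n : nat) (x : R) : solenoidal x ->
  exists T, forall t, (T <= t)%nat ->
    U n 0 (fiter (F 0) t x) /\ forall j, ~ core n 0 j (fiter (F 0) t x).
Proof.
  intro H. destruct (H n) as [T1 H1]. destruct (eventually_outside_cores n 0 x) as [T2 H2].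
  exists (T1 + T2)%nat. intros t Ht. split; [|intro; apply H2; lia].
  replace t with ((t - T1) + T1)%nat by lia. rewrite fiter_add. apply fiter_U, H1.
Qed.

(** Whenever the orbit of [x] is near [z], it lies in some [J n 0 j] outside the core. The orbit of
    [y] visits the same interval, also outside the core, hence at distance at most [ell n - / 2]
    from that iterate of [x]. *)
Lemma omega_solenoidal_subset (x y : R) :
  solenoidal x -> solenoidal y -> subset (omega (F 0) x) (omega (F 0) y).
Proof.
  intros Hx Hy z Hz e He N.
  destruct (ell_small (e / 2)) as [n Hn]; [lra|].
  destruct (solenoidal_eventually n x Hx) as [T1 H1].
  destruct (solenoidal_eventually n y Hy) as [T2 H2].
  destruct (Hz (e / 2) ltac:(lra) T1) as (t & Ht & _ & Hc).
  destruct (H1 t Ht) as [[j Hj] Hcx].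
  destruct (H2 T2 (le_n _)) as [HU _].
  destruct (fiter_visits n 0 _ j (S N) HU) as (s & Hs & Hjs).
  rewrite <- fiter_add in Hjs. exists (s + T2)%nat. split; [lia|]. split; [lia|].
  destruct (H2 (s + T2)%nat ltac:(lia)) as [_ Hcy].
  assert (Hd := outside_core_close n 0 j _ _ Hj Hjs (Hcx j) (Hcy j)).
  rewrite Nat.add_0_r in Hd.
  apply Rabs_le_bounds in Hd. apply Rabs_def2 in Hc. apply Rabs_def1; lra.
Qed.

(** * Absence of Li-Yorke pairs *)

Definition asymptotic (f : R -> R) (x y : R) : Prop :=
  forall e, 0 < e -> exists T, forall t, (T <= t)%nat ->
    Rabs (fiter f t x - fiter f t y) < e.

Definition distal (f : R -> R) (x y : R) : Prop :=
  exists d T, 0 < d /\ forall t, (T <= t)%nat -> d <= Rabs (fiter f t x - fiter f t y).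

(** Two orbits that are once in the same interval of level [n] remain in a common one at all later
    times. If this happens for all [n], [outside_core_close] makes them asymptotic; otherwise
    [J_separated] keeps them apart. *)
Lemma solenoidal_pair (x y : R) :
  solenoidal x -> solenoidal y -> asymptotic (F 0) x y \/ distal (F 0) x y.
Proof.
  intros Hx Hy.
  destruct (classic (forall n, exists t j, J n 0 j (fiter (F 0) t x) /\
                                           J n 0 j (fiter (F 0) t y))) as [H|H].
  - left. intros e He. destruct (ell_small e He) as [n Hn].
    destruct (H n) as (t0 & j & Hjx & Hjy).
    destruct (solenoidal_eventually n x Hx) as [T1 H1].
    destruct (solenoidal_eventually n y Hy) as [T2 H2].
    exists (t0 + T1 + T2)%nat. intros t Ht.
    destruct (H1 t ltac:(lia)) as [_ Hcx]. destruct (H2 t ltac:(lia)) as [_ Hcy].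
    apply (fiter_J _ _ (t - t0)) in Hjx. apply (fiter_J _ _ (t - t0)) in Hjy.
    rewrite <- fiter_add in Hjx, Hjy.
    replace (t - t0 + t0)%nat with t in Hjx, Hjy by lia.
    assert (Hd := outside_core_close n 0 _ _ _ Hjx Hjy (Hcx _) (Hcy _)).
    rewrite Nat.add_0_r in Hd. lra.
  - right. apply not_all_ex_not in H. destruct H as [n Hn].
    destruct (J_separated n 0) as (d & Hd & Hsep).
    destruct (solenoidal_eventually n x Hx) as [T1 H1].
    destruct (solenoidal_eventually n y Hy) as [T2 H2].
    exists d, (T1 + T2)%nat. split; [exact Hd|]. intros t Ht.
    apply Rnot_lt_le. intro Hlt.
    destruct (H1 t ltac:(lia)) as [[i Hi] _]. destruct (H2 t ltac:(lia)) as [[j Hj] _].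
    apply Hn. exists t, j. split; [|exact Hj].
    eapply J_congr; [|exact Hi]. eapply Hsep; eauto.
Qed.

Lemma positive_lower_bound (u : nat -> R) (n : nat) :
  (forall i, (i < n)%nat -> 0 < u i) -> exists d, 0 < d /\ forall i, (i < n)%nat -> d <= u i.
Proof.
  induction n as [|n IH]; intro H; [exists 1; split; [lra | intros; lia]|].
  destruct IH as (d & Hd & Hl); [intros; apply H; lia|].
  exists (Rmin d (u n)). split; [apply Rmin_glb_lt; [exact Hd | apply H; lia]|].
  intros i Hi. destruct (Nat.eq_dec i n) as [->|Hne]; [apply Rmin_r|].
  eapply Rle_trans; [apply Rmin_l | apply Hl; lia].
Qed.

Lemma periodic_pair (f : R -> R) (x y : R) :
  eventually_periodic f x -> eventually_periodic f y -> asymptotic f x y \/ distal f x y.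
Proof.
  intros (t & p & Hp & Hx) (s & q & Hq & Hy).
  destruct (classic (exists u, fiter f u x = fiter f u y)) as [[u Hu]|H].
  - left. intros e He. exists u. intros v Hv. replace v with ((v - u) + u)%nat by lia.
    rewrite !fiter_add, Hu, Rminus_diag, Rabs_R0. exact He.
  - right.
    (* From time [t + s] on, both orbits have the period [p * q], so the distance of the orbits
       takes finitely many values, all positive. *)
    assert (Hx' : fiter f (t + s + p * q) x = fiter f (t + s) x).
    { replace (t + s + p * q)%nat with (s + (t + q * p))%nat by lia.
      rewrite fiter_add, eventually_periodic_iter, <- fiter_add by assumption.
      f_equal; lia. }
    assert (Hy' : fiter f (t + s + p * q) y = fiter f (t + s) y).
    { replace (t + s + p * q)%nat with (t + (s + p * q))%nat by lia.
      rewrite fiter_add, eventually_periodic_iter, <- fiter_add by assumption.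
      f_equal; lia. }
    destruct (positive_lower_bound
      (fun i => Rabs (fiter f (t + s + i) x - fiter f (t + s + i) y)) (p * q))
      as (d & Hd & Hl).
    { intros i _. apply Rabs_pos_lt. intro H0. apply H. exists (t + s + i)%nat. lra. }
    exists d, (t + s)%nat. split; [exact Hd|]. intros v Hv.
    set (i := ((v - (t + s)) mod (p * q))%nat). set (c := ((v - (t + s)) / (p * q))%nat).
    assert (Hpq : (p * q <> 0)%nat) by lia.
    assert (Hi : (i < p * q)%nat) by (apply Nat.mod_upper_bound; exact Hpq).
    assert (Hv' : v = (i + (t + s + c * (p * q)))%nat).
    { pose proof (Nat.div_mod (v - (t + s)) (p * q) Hpq). fold i c in H0. lia. }
    specialize (Hl i Hi). cbv beta in Hl.
    rewrite !(Nat.add_comm (t + s) i), !fiter_add in Hl.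
    rewrite Hv', !(fiter_add f i), !eventually_periodic_iter by assumption.
    rewrite !fiter_add. exact Hl.
Qed.

(** For some [n] the orbit of [y] never meets the closed set [U n 0]; the finitely many points of
    its cycle have a positive distance from that set, which the orbit of [x] finally never
    leaves. *)
Lemma solenoidal_periodic_pair (x y : R) :
  solenoidal x -> ~ solenoidal y -> eventually_periodic (F 0) y -> distal (F 0) x y.
Proof.
  intros Hx Hns (t & p & Hp & Hy). apply not_all_ex_not in Hns. destruct Hns as [n Hn].
  assert (Hd : forall m, exists d, 0 < d /\ forall i z, (i < m)%nat -> U n 0 z ->
     d <= Rabs (fiter (F 0) (t + i) y - z)).
  { induction m as [|m (d & Hd & Hm)]; [exists 1; split; [lra | intros; lia]|].
    destruct (U_closed n 0 (fiter (F 0) (t + m) y)) as (d' & Hd' & Hm').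
    { intro HU. apply Hn. eauto. }
    exists (Rmin d d'). split; [now apply Rmin_glb_lt|]. intros i z Hi Hz.
    destruct (Nat.eq_dec i m) as [->|Hne].
    - eapply Rle_trans; [apply Rmin_r | auto].
    - eapply Rle_trans; [apply Rmin_l | apply Hm; [lia | exact Hz]]. }
  destruct (Hd p) as (d & Hd0 & Hl). destruct (solenoidal_eventually n x Hx) as [T HT].
  exists d, (T + t)%nat. split; [exact Hd0|]. intros u Hu.
  destruct (eventually_periodic_reduce (F 0) y t p u Hp Hy ltac:(lia)) as (i & Hi & ->).
  rewrite Rabs_minus_sym. apply Hl; [exact Hi|]. apply HT. lia.
Qed.

Lemma distal_sym (f : R -> R) (x y : R) : distal f x y -> distal f y x.
Proof.
  intros (d & T & Hd & H). exists d, T. split; [exact Hd|]. intros t Ht.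
  rewrite Rabs_minus_sym. auto.
Qed.

Lemma pair_dichotomy (x y : R) :
  inL 0 x -> inL 0 y -> asymptotic (F 0) x y \/ distal (F 0) x y.
Proof.
  intros Hx Hy. destruct (classic (solenoidal x)) as [Sx|Sx];
    destruct (classic (solenoidal y)) as [Sy|Sy].
  - now apply solenoidal_pair.
  - right. apply solenoidal_periodic_pair; auto using not_solenoidal_periodic.
  - right. apply distal_sym, solenoidal_periodic_pair; auto using not_solenoidal_periodic.
  - apply periodic_pair; auto using not_solenoidal_periodic.
Qed.

Lemma inI_inL (x : R) : inI x <-> inL 0 x.
Proof. unfold inI, inL. rewrite ell_0. reflexivity. Qed.

Lemma F_not_li_yorke : ~ li_yorke_chaotic (F 0).
Proof.
  (* No two distinct points of [S] can exist, so even a constant map into [nat] is injective on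
     [S]. *)
  intros (S & HI & Hunc & HS). apply Hunc. exists (fun _ => 0%nat).
  intros x y Hx Hy _. apply NNPP. intro Hne.
  destruct (HS x y Hx Hy Hne) as [(e & He & Hsup) Hinf].
  destruct (pair_dichotomy x y) as [Ha | (d & T & Hd & Hdist)];
    [now apply inI_inL, HI | now apply inI_inL, HI | |].
  - destruct (Ha e He) as [T HT]. destruct (Hsup T) as (n & Hn & Hgt).
    specialize (HT n Hn). lra.
  - destruct (Hinf d Hd T) as (n & Hn & Hlt). specialize (Hdist n Hn). lra.
Qed.

(** * Zero entropy *)

(** A labelling of [L_k] by [N] labels in which points with the same label are not
    [(n, e)]-separated; it bounds the size of separated sets by [N]. Labels, unlike covers, combine
    easily into pairs. *)
Definition code (e : R) (k n N : nat) (c : R -> nat) : Prop :=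
  (forall x, inL k x -> (c x < N)%nat) /\
  forall x y, inL k x -> inL k y -> c x = c y ->
    forall i, (i < n)%nat -> Rabs (fiter (F k) i x - fiter (F k) i y) <= e.

Lemma pieces (e : R) : 0 < e -> exists (P : nat) (c : R -> nat),
  (forall x, 0 <= x <= 1 -> (c x < P)%nat) /\
  (forall x y, 0 <= x <= 1 -> 0 <= y <= 1 -> c x = c y -> Rabs (x - y) <= e).
Proof.
  intro He.
  assert (Hx : forall x, 0 <= x <= 1 -> 0 <= x / e <= 1 / e).
  { intros x Hx. unfold Rdiv. pose proof (Rinv_0_lt_compat e He). nra. }
  exists (S (Z.to_nat (up (1 / e) + 1))), (fun x => Z.to_nat (up (x / e))).
  assert (Hup : forall x, 0 <= x <= 1 -> (0 < up (x / e) <= up (1 / e) + 1)%Z).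
  { intros x H. specialize (Hx x H). pose proof (archimed (x / e)).
    pose proof (archimed (1 / e)). split.
    - apply lt_IZR. lra.
    - apply le_IZR. rewrite plus_IZR. lra. }
  split.
  - intros x H. specialize (Hup x H). lia.
  - intros x y Hx0 Hy0 Heq. pose proof (Hup x Hx0). pose proof (Hup y Hy0).
    apply Z2Nat.inj in Heq; [|lia|lia].
    pose proof (archimed (x / e)). pose proof (archimed (y / e)). rewrite Heq in *.
    replace (x - y) with (e * (x / e - y / e)) by (field; lra).
    rewrite Rabs_mult, (Rabs_right e) by lra.
    assert (Rabs (x / e - y / e) <= 1) by (apply Rabs_le; lra). nra.
Qed.

Lemma pair_code_inj (P a b a' b' : nat) :
  (a < P)%nat -> (a' < P)%nat -> (a + P * b = a' + P * b')%nat -> a = a' /\ b = b'.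
Proof.
  intros Ha Ha' H.
  assert (Hb : b = b').
  { transitivity ((a + P * b) / P)%nat.
    - apply Nat.div_unique with a; lia.
    - symmetry. apply Nat.div_unique with a'; lia. }
  subst b'. lia.
Qed.

Lemma pair_code_lt (P N a b : nat) :
  (a < P)%nat -> (b < N)%nat -> (a + P * b < P * N)%nat.
Proof. nia. Qed.

Lemma inL_unit (k : nat) (x : R) : inL k x -> 0 <= x <= 1.
Proof. pose proof (level_order k). unfold inL. lra. Qed.

(** The label is the itinerary through the [P] small pieces. This gives a first exponential bound,
    which is then halved repeatedly. *)
Lemma code_trivial (e : R) (P : nat) (pc : R -> nat) :
  (forall x, 0 <= x <= 1 -> (pc x < P)%nat) ->
  (forall x y, 0 <= x <= 1 -> 0 <= y <= 1 -> pc x = pc y -> Rabs (x - y) <= e) ->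
  forall k n, exists c, code e k n (P ^ n) c.
Proof.
  intros HP Hpc k n. induction n as [|n (c & Hc & Hcc)].
  - exists (fun _ => 0%nat). split; [intros; simpl; lia | intros; lia].
  - exists (fun x => pc x + P * c (F k x))%nat. split.
    + intros x Hx. rewrite Nat.pow_succ_r'. apply pair_code_lt.
      * apply HP, (inL_unit k), Hx.
      * apply Hc, F_inL.
    + intros x y Hx Hy Heq.
      apply pair_code_inj in Heq; try (apply HP, (inL_unit k); assumption).
      destruct Heq as [H1 H2]. intros [|i] Hi.
      * apply Hpc; try apply (inL_unit k); assumption.
      * rewrite !fiter_S_r. apply Hcc; auto using F_inL. lia.
Qed.

Lemma even_odd_nat (i : nat) : exists q, i = (2 * q)%nat \/ i = S (2 * q).
Proof.
  exists (i / 2)%nat. pose proof (Nat.div_mod i 2). pose proof (Nat.mod_upper_bound i 2). lia.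
Qed.

(** Even iterates follow [F (S k)], and odd ones are contracted by [emb k] after a possible further
    application of [F (S k)]. The strict inequality [n < 2 * m] guarantees that this further iterate
    still has index below [m]. *)
Lemma low_orbits_close (e : R) (k n m : nat) (x y : R) :
  inL (S k) x -> inL (S k) y -> (n < 2 * m)%nat ->
  (forall i, (i < m)%nat -> Rabs (fiter (F (S k)) i x - fiter (F (S k)) i y) <= e) ->
  forall i, (i < n)%nat -> Rabs (fiter (F k) i x - fiter (F k) i y) <= e.
Proof.
  intros Hx Hy Hm H i Hi. destruct (even_odd_nat i) as [q [-> | ->]].
  - rewrite !fiter_double_low by assumption. apply H. lia.
  - cbn [fiter]. rewrite !fiter_double_low by assumption.
    rewrite !F_low by (apply fiter_inL; assumption).
    eapply Rle_trans; [apply emb_contract|].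
    assert (Hq : Rabs (al k (F (S k)) (fiter (F (S k)) q x)
                       - al k (F (S k)) (fiter (F (S k)) q y)) <= e).
    { unfold al. destruct Nat.even; [apply H; lia|]. apply (H (S q)). lia. }
    pose proof (Rabs_pos (al k (F (S k)) (fiter (F (S k)) q x)
                       - al k (F (S k)) (fiter (F (S k)) q y))). lra.
Qed.

Lemma high_orbits_close (e : R) (k n m : nat) (x y : R) :
  inL (S k) x -> inL (S k) y -> (n < 2 * m)%nat ->
  (forall i, (i < m)%nat -> Rabs (fiter (F (S k)) i x - fiter (F (S k)) i y) <= e) ->
  forall i, (i < n)%nat -> Rabs (fiter (F k) i (emb k x) - fiter (F k) i (emb k y)) <= e.
Proof.
  intros Hx Hy Hm H i Hi. destruct (even_odd_nat i) as [q [-> | ->]].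
  - rewrite !fiter_double_emb by assumption. eapply Rle_trans; [apply emb_contract|].
    specialize (H q ltac:(lia)).
    pose proof (Rabs_pos (fiter (F (S k)) q x - fiter (F (S k)) q y)). lra.
  - cbn [fiter]. rewrite !fiter_double_emb by assumption.
    rewrite !F_emb by (apply fiter_inL; assumption). unfold be.
    destruct Nat.even; [apply (H (S q)); lia | apply H; lia].
Qed.

Definition in_LR (k : nat) (x : R) : bool :=
  if Rle_dec x (ell (S k)) then true else if Rle_dec (emb k 0) x then true else false.

Lemma in_LR_spec (k : nat) (x : R) :
  if in_LR k x then LR k x else ell (S k) < x < emb k 0.
Proof. unfold in_LR, LR. repeat destruct Rle_dec; lra. Qed.

(** Even labels belong to L and odd ones to R. The clamps keep the argument of [c] in [L_(k+1)], so
    that the bound on labels holds for every [x]. *)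
Definition lr_code (k : nat) (c : R -> nat) (x : R) : nat :=
  if Rle_dec x (ell (S k)) then (2 * c (clamp 0 (ell (S k)) x))%nat
  else (1 + 2 * c (clamp 0 (ell (S k)) (emb_inv k x)))%nat.

Lemma lr_code_lt (e : R) (k m N : nat) (c : R -> nat) (x : R) :
  code e (S k) m N c -> (lr_code k c x < 2 * N)%nat.
Proof.
  intros [Hc _].
  assert (H : forall z, (c (clamp 0 (ell (S k)) z) < N)%nat).
  { intro z. apply Hc, clamp_in. pose proof (level_order k). lra. }
  unfold lr_code. destruct Rle_dec.
  - specialize (H x). lia.
  - specialize (H (emb_inv k x)). lia.
Qed.

Lemma lr_code_close (e : R) (k n m N : nat) (c : R -> nat) (x y : R) :
  code e (S k) m N c -> (n < 2 * m)%nat ->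
  inL k x -> inL k y -> LR k x -> LR k y -> lr_code k c x = lr_code k c y ->
  forall i, (i < n)%nat -> Rabs (fiter (F k) i x - fiter (F k) i y) <= e.
Proof.
  intros [_ Hc] Hm Hx Hy Lx Ly Heq. unfold lr_code, LR, inL in *.
  destruct (Rle_dec x (ell (S k))), (Rle_dec y (ell (S k))); [| lia | lia |].
  - rewrite !clamp_id in Heq by lra.
    apply low_orbits_close with m; unfold inL; try lra; [exact Hm|].
    apply Hc; unfold inL; try lra. lia.
  - assert (H1 : inL (S k) (emb_inv k x)) by (apply emb_inv_inL; lra).
    assert (H2 : inL (S k) (emb_inv k y)) by (apply emb_inv_inL; lra).
    rewrite !clamp_id in Heq by assumption.
    rewrite <- (emb_invK k x), <- (emb_invK k y).
    apply high_orbits_close with m; try assumption.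
    apply Hc; try assumption. lia.
Qed.

(** The value [n] is the default for orbits that stay in the gap at all times below [n]. *)
Fixpoint exit_time (k n : nat) (x : R) : nat :=
  match n with
  | O => O
  | S n' => if in_LR k x then O else S (exit_time k n' (F k x))
  end.

Lemma exit_time_le (k n : nat) (x : R) : (exit_time k n x <= n)%nat.
Proof.
  revert x. induction n as [|n IH]; intro x; simpl; [lia|].
  destruct in_LR; [lia|]. specialize (IH (F k x)). lia.
Qed.

Lemma before_exit (k n i : nat) (x : R) :
  (i < exit_time k n x)%nat -> ell (S k) < fiter (F k) i x < emb k 0.
Proof.
  revert x i. induction n as [|n IH]; intros x i; simpl; [lia|].
  pose proof (in_LR_spec k x) as Hs. destruct in_LR; [lia|].
  intro Hi. destruct i as [|i]; [exact Hs|]. rewrite fiter_S_r. apply IH. lia.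
Qed.

Lemma at_exit (k n : nat) (x : R) :
  (exit_time k n x < n)%nat -> LR k (fiter (F k) (exit_time k n x) x).
Proof.
  revert x. induction n as [|n IH]; intros x; [simpl; lia|]. cbn [exit_time].
  pose proof (in_LR_spec k x) as Hs. destruct in_LR; [intros _; exact Hs|].
  intro Hi. rewrite fiter_S_r. apply IH. lia.
Qed.

(** The label has three parts: the exit time from the gap, with [S n] values; the piece that
    contains the last point before the exit, with [P] values; and the code of the orbit after the
    exit, with [2 * N] values. *)
Lemma code_step (e : R) (P : nat) (pc : R -> nat) :
  (forall x, 0 <= x <= 1 -> (pc x < P)%nat) ->
  (forall x y, 0 <= x <= 1 -> 0 <= y <= 1 -> pc x = pc y -> Rabs (x - y) <= e) ->
  forall k n m N c, code e (S k) m N c -> (n < 2 * m)%nat ->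
  exists c', code e k n (S n * (P * (2 * N))) c'.
Proof.
  intros HP Hpc k n m N c Hc Hm.
  set (tm := exit_time k n).
  (* For exit time 0 the predecessor is 0 as well; this is harmless, as there is then no time before
     the exit. *)
  set (last := fun x => fiter (F k) (pred (tm x)) x).
  exists (fun x => tm x + S n * (pc (last x) + P * lr_code k c (fiter (F k) (tm x) x)))%nat.
  assert (Ht : forall x, (tm x < S n)%nat).
  { intro x. pose proof (exit_time_le k n x). unfold tm. lia. }
  assert (Hl : forall x, inL k x -> 0 <= last x <= 1).
  { intros x Hx. apply (inL_unit k), fiter_inL, Hx. }
  split.
  - intros x Hx. apply pair_code_lt; [apply Ht|]. apply pair_code_lt; [apply HP, Hl, Hx|].
    eapply lr_code_lt, Hc.
  - intros x y Hx Hy Heq i Hi.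
    apply pair_code_inj in Heq; [|apply Ht|apply Ht]. destruct Heq as [Et Heq].
    apply pair_code_inj in Heq; [|apply HP, Hl, Hx|apply HP, Hl, Hy].
    destruct Heq as [Ep Ec].
    apply Hpc in Ep; [|apply Hl, Hx|apply Hl, Hy].
    destruct (Nat.lt_ge_cases i (tm x)) as [Hlt|Hge].
    + (* the gap is expanded, so the last distance before the exit is the largest *)
      unfold last in Ep. rewrite <- Et in Ep.
      destruct (F_gap k) as (s & Hs & HF).
      assert (Hmono : forall r, (i + r < tm x)%nat ->
        Rabs (fiter (F k) i x - fiter (F k) i y)
        <= Rabs (fiter (F k) (i + r) x - fiter (F k) (i + r) y)).
      { induction r as [|r IH]; intro Hr; [rewrite Nat.add_0_r; lra|].
        rewrite Nat.add_succ_r. cbn [fiter].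
        pose proof (before_exit k n (i + r) x) as Bx.
        pose proof (before_exit k n (i + r) y) as By.
        fold tm in Bx, By. rewrite HF.
        - specialize (IH ltac:(lia)).
          pose proof (Rabs_pos (fiter (F k) (i + r) x - fiter (F k) (i + r) y)). nra.
        - specialize (Bx ltac:(lia)). lra.
        - rewrite Et in Hr. specialize (By ltac:(lia)). lra. }
      specialize (Hmono (pred (tm x) - i)%nat ltac:(lia)).
      replace (i + (pred (tm x) - i))%nat with (pred (tm x)) in Hmono by lia. lra.
    + replace i with ((i - tm x) + tm x)%nat by lia. rewrite (fiter_add _ _ (tm x) x).
      rewrite Et at 3 4. rewrite fiter_add.
      pose proof (at_exit k n x) as Ax. pose proof (at_exit k n y) as Ay.
      fold tm in Ax, Ay.
      rewrite Et. eapply lr_code_close; try eassumption.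
      * apply fiter_inL, Hx.
      * apply fiter_inL, Hy.
      * rewrite <- Et. apply Ax. lia.
      * apply Ay. lia.
      * rewrite Et in Ec. exact Ec.
      * lia.
Qed.

(** * Exponential growth rates *)

Lemma exp_le (x y : R) : x <= y -> exp x <= exp y.
Proof.
  intro H. destruct (Rle_lt_or_eq_dec _ _ H) as [Hlt | ->].
  - now apply Rlt_le, exp_increasing.
  - apply Rle_refl.
Qed.

(** The constant is uniform in [k], because a bound at level [k] is derived from one at level
    [S k]. *)
Definition growth (e h : R) : Prop :=
  exists C, 0 < C /\ forall k n, exists N c,
    code e k n N c /\ INR N <= C * exp (h * INR n).

(** The crude rate [INR P] in place of the logarithm of [P] suffices, by [P <= exp P]. *)
Lemma growth_trivial (e : R) (P : nat) (pc : R -> nat) :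
  (forall x, 0 <= x <= 1 -> (pc x < P)%nat) ->
  (forall x y, 0 <= x <= 1 -> 0 <= y <= 1 -> pc x = pc y -> Rabs (x - y) <= e) ->
  growth e (INR P).
Proof.
  intros HP Hpc. exists 1. split; [lra|]. intros k n.
  destruct (code_trivial e P pc HP Hpc k n) as [c Hc]. exists (P ^ n)%nat, c.
  split; [exact Hc|]. rewrite Rmult_1_l. clear c Hc. induction n as [|n IH].
  - simpl. rewrite Rmult_0_r, exp_0. lra.
  - rewrite Nat.pow_succ_r', mult_INR, S_INR, Rmult_plus_distr_l, exp_plus, Rmult_1_r.
    rewrite Rmult_comm. apply Rmult_le_compat; try apply pos_INR; [exact IH|].
    pose proof (exp_ineq1_le (INR P)). lra.
Qed.

(** [code_step] reduces time [n] to time [n / 2 + 1] one level higher, which halves the rate; the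
    linear factor [S n] costs an arbitrarily small [d]. *)
Lemma growth_halve (e : R) (P : nat) (pc : R -> nat) :
  (forall x, 0 <= x <= 1 -> (pc x < P)%nat) ->
  (forall x y, 0 <= x <= 1 -> 0 <= y <= 1 -> pc x = pc y -> Rabs (x - y) <= e) ->
  forall h d, 0 <= h -> 0 < d -> growth e h -> growth e (h / 2 + d).
Proof.
  intros HP Hpc h d Hh Hd (C & HC & H).
  assert (P0 : 1 <= INR P).
  { apply (le_INR 1). specialize (HP 0 ltac:(lra)). lia. }
  (* The factor [1 + / d] serves to bound [S n] by a multiple of [exp (d * n)], [INR P] and 2 come
     from [code_step], and [exp h] pays for the extra unit of time in [n / 2 + 1]. *)
  exists ((1 + / d) * (INR P * (2 * (C * exp h)))). split.
  { pose proof (exp_pos h). pose proof (Rinv_0_lt_compat d Hd).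
    repeat apply Rmult_lt_0_compat; lra. }
  intros k n. set (m := S (n / 2)).
  assert (Hm : (n < 2 * m)%nat).
  { unfold m. pose proof (Nat.div_mod n 2). pose proof (Nat.mod_upper_bound n 2). lia. }
  assert (Hm2 : INR m <= INR n / 2 + 1).
  { unfold m. rewrite S_INR. apply Rplus_le_compat_r.
    assert (INR (2 * (n / 2)) <= INR n) by (apply le_INR, Nat.Div0.mul_div_le).
    rewrite mult_INR in H0. change (INR 2) with 2 in H0. lra. }
  destruct (H (S k) m) as (N & c & Hc & HN).
  destruct (code_step e P pc HP Hpc k n m N c Hc Hm) as [c' Hc'].
  exists (S n * (P * (2 * N)))%nat, c'. split; [exact Hc'|].
  rewrite !mult_INR. change (INR 2) with 2.
  assert (HN' : INR N <= C * exp h * exp (h / 2 * INR n)).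
  { eapply Rle_trans; [exact HN|]. rewrite Rmult_assoc, <- exp_plus.
    apply Rmult_le_compat_l; [lra|].
    apply exp_le. nra. }
  assert (Hn : INR (S n) <= (1 + / d) * exp (d * INR n)).
  { rewrite S_INR. pose proof (exp_ineq1_le (d * INR n)). pose proof (pos_INR n).
    pose proof (Rinv_0_lt_compat d Hd).
    apply Rle_trans with ((1 + / d) * (1 + d * INR n)).
    - replace ((1 + / d) * (1 + d * INR n)) with (1 + INR n + / d + d * INR n)
        by (field; lra). nra.
    - apply Rmult_le_compat_l; lra. }
  rewrite (Rmult_plus_distr_r (h / 2)), exp_plus.
  set (E1 := exp (h / 2 * INR n)) in *. set (E2 := exp (d * INR n)) in *.
  replace ((1 + / d) * (INR P * (2 * (C * exp h))) * (E1 * E2))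
    with (((1 + / d) * E2) * (INR P * (2 * (C * exp h * E1)))) by ring.
  pose proof (pos_INR N). pose proof (pos_INR (S n)).
  apply Rmult_le_compat; [apply pos_INR | nra | exact Hn | nra].
Qed.

(** Repeated halving with loss [d / 4] has the fixed point [d / 2]: after [m] rounds the rate is
    [INR P * / 2 ^ m + d / 2], which is finally below [d]. *)
Lemma growth_any (e : R) : 0 < e -> forall d, 0 < d -> growth e d.
Proof.
  intros He d Hd. destruct (pieces e He) as (P & pc & HP & Hpc).
  assert (H : forall m, growth e (INR P * / 2 ^ m + d / 2)).
  { induction m as [|m IH].
    - destruct (growth_trivial e P pc HP Hpc) as (C & HC & H). exists C.
      split; [exact HC|]. intros k n. destruct (H k n) as (N & c & Hc & HN).
      exists N, c. split; [exact Hc|]. eapply Rle_trans; [exact HN|].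
      apply Rmult_le_compat_l; [lra|].
      apply exp_le. pose proof (pos_INR n). simpl. rewrite Rinv_1. nra.
    - replace (INR P * / 2 ^ S m + d / 2) with ((INR P * / 2 ^ m + d / 2) / 2 + d / 4)
        by (rewrite inv_pow2_S; field; apply pow_nonzero; lra).
      apply (growth_halve e P pc HP Hpc); [|lra|exact IH].
      pose proof (pos_INR P). pose proof (inv_pow2_bounds m). nra. }
  assert (P0 : 1 <= INR P).
  { apply (le_INR 1). specialize (HP 0 ltac:(lra)). lia. }
  destruct (inv_pow2_small (d / 2 / INR P)) as [m Hm]; [apply Rdiv_lt_0_compat; lra|].
  specialize (Hm m (le_n m)). destruct (H m) as (C & HC & HG). exists C.
  split; [exact HC|]. intros k n. destruct (HG k n) as (N & c & Hc & HN).
  exists N, c. split; [exact Hc|]. eapply Rle_trans; [exact HN|].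
  apply Rmult_le_compat_l; [lra|].
  apply (Rmult_lt_compat_l (INR P)) in Hm; [|lra].
  replace (INR P * (d / 2 / INR P)) with (d / 2) in Hm by (field; lra).
  apply exp_le. pose proof (pos_INR n). nra.
Qed.

(** Pigeonhole: the labels of the points of a separated list are distinct. *)
Lemma code_separated (e : R) (n N : nat) (c : R -> nat) (l : list R) :
  code e 0 n N c -> separated (F 0) n e l -> (length l <= N)%nat.
Proof.
  intros [Hc Hcc] (Hnd & HI & Hsep).
  rewrite <- (length_map c l), <- (length_seq N 0). apply NoDup_incl_length.
  - apply NoDup_map_NoDup_ForallPairs; [|exact Hnd].
    intros x y Hx Hy Heq. apply NNPP. intro Hne.
    destruct (Hsep x y Hx Hy Hne) as (i & Hi & Hgt).
    assert (H := Hcc x y (proj1 (inI_inL x) (HI x Hx)) (proj1 (inI_inL y) (HI y Hy))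
                   Heq i Hi). lra.
  - intros i Hi. apply in_map_iff in Hi. destruct Hi as (x & <- & Hx).
    apply in_seq. specialize (Hc x (proj1 (inI_inL x) (HI x Hx))). lia.
Qed.

Lemma F_zero_entropy : zero_entropy (F 0).
Proof.
  intros e He d Hd. destruct (growth_any e He (d / 2)) as (C & HC & H); [lra|].
  (* From this time on [C <= d / 2 * n <= exp (d / 2 * n)], so the second half of the exponent
     absorbs the constant. *)
  exists (Z.to_nat (up (2 * C / d))). intros n Hn l Hl.
  destruct (H 0%nat n) as (N & c & Hc & HN).
  apply Rle_trans with (INR N); [apply le_INR; eapply code_separated; eassumption|].
  eapply Rle_trans; [exact HN|].
  replace (d * INR n) with (d / 2 * INR n + d / 2 * INR n) by field. rewrite exp_plus.
  apply Rmult_le_compat_r; [apply Rlt_le, exp_pos|].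
  assert (Hup : 2 * C / d <= INR n).
  { pose proof (archimed (2 * C / d)).
    assert (0 < 2 * C / d) by (apply Rdiv_lt_0_compat; lra).
    apply Rle_trans with (IZR (up (2 * C / d))); [lra|].
    rewrite INR_IZR_INZ. apply IZR_le. lia. }
  apply (Rmult_le_compat_l (d / 2)) in Hup; [|lra].
  replace (d / 2 * (2 * C / d)) with C in Hup by (field; lra).
  pose proof (exp_ineq1_le (d / 2 * INR n)). lra.
Qed.

(** * The infinite omega-limit set *)

(** The index [j] codes the choice of R at all [m] levels. *)
Lemma J_top (m k : nat) : exists j, forall x, J m k j x -> ell k - / 2 ^ m <= x.
Proof.
  revert k. induction m as [|m IH]; intro k.
  - exists 0%Z. intros x [Hx _]. pose proof (level_order k). simpl. lra.
  - destruct (IH (S k)) as [j Hj]. exists (2 * (j - par k) + 1)%Z. intros x Hx.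
    rewrite J_odd in Hx. destruct Hx as (y & Hy & ->).
    replace (j - par k + par k)%Z with j in Hy by ring. apply Hj in Hy.
    rewrite <- (emb_ell k), inv_pow2_S. pose proof (scale_bounds k).
    pose proof (inv_pow2_bounds m). pose proof (emb_sub k (ell (S k)) y). nra.
Qed.

Lemma U_ell (n k : nat) : U n k (ell k).
Proof.
  revert k. induction n as [|n IH]; intro k.
  - exists 0%Z. apply inL_ell.
  - apply U_S. right. exists (ell (S k)). split; [apply IH | now rewrite emb_ell].
Qed.

Lemma solenoidal_one : solenoidal 1.
Proof. intro n. exists 0%nat. rewrite <- ell_0. apply U_ell. Qed.

Lemma U_one (n t : nat) : U n 0 (fiter (F 0) t 1).
Proof. apply fiter_U. rewrite <- ell_0. apply U_ell. Qed.

Lemma omega_F (f : R -> R) (x y : R) :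
  continuity f -> omega f x y -> omega f x (f y).
Proof.
  intros Hf Hy e He N. destruct (Hf y e He) as (d & Hd & H).
  destruct (Hy d Hd N) as (n & Hn & Hn1 & Hc). exists (S n).
  split; [lia|]. split; [lia|]. cbn [fiter].
  destruct (Req_dec (fiter f n x) y) as [->|Hne].
  - rewrite Rminus_diag, Rabs_R0. exact He.
  - apply (H (fiter f n x)). split; [|exact Hc].
    split; [exact I | intro Heq; now apply Hne].
Qed.

(** The orbit of 1 visits the rightmost interval of every level again and again, so 1 is recurrent;
    the rest follows from the invariance of omega-limit sets. *)
Lemma omega_one (s : nat) : omega (F 0) 1 (fiter (F 0) s 1).
Proof.
  induction s as [|s IH]; [|cbn [fiter]; apply omega_F; [apply continuity_F | exact IH]].
  intros e He N. destruct (inv_pow2_small e He) as [m Hm]. specialize (Hm m (le_n m)).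
  destruct (J_top m 0) as [j Hj].
  destruct (fiter_visits m 0 1 j (S N) (U_one m 0)) as (t & Ht & HJ).
  exists t. split; [lia|]. split; [lia|]. assert (Hi := J_inL _ _ _ _ HJ).
  apply Hj in HJ. unfold inL in Hi. rewrite ell_0 in *. cbn [fiter].
  apply Rabs_def1; lra.
Qed.

Lemma omega_one_U (n : nat) (x : R) : omega (F 0) 1 x -> U n 0 x.
Proof.
  intro Hx. apply NNPP. intro Hn. destruct (U_closed n 0 x Hn) as (d & Hd & H).
  destruct (Hx d Hd 0%nat) as (t & _ & _ & Hc). specialize (H _ (U_one n t)).
  rewrite Rabs_minus_sym in H. lra.
Qed.

Lemma fiter_one_inj (s t : nat) : fiter (F 0) s 1 = fiter (F 0) t 1 -> s = t.
Proof.
  intro H. apply NNPP. intro Hne.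
  destruct (no_large_pow2_divides (Z.of_nat s - Z.of_nat t)) as [n Hn]; [lia|].
  apply Hn. destruct (U_one n 0) as [j Hj].
  assert (Hs := fiter_J n 0 s j _ Hj). assert (Ht := fiter_J n 0 t j _ Hj).
  cbn [fiter] in Hs, Ht. rewrite H in Hs. assert (Hd := J_disjoint _ _ _ _ _ Hs Ht).
  now replace (j + Z.of_nat s - (j + Z.of_nat t))%Z
    with (Z.of_nat s - Z.of_nat t)%Z in Hd by ring.
Qed.

Lemma omega_one_infinite : set_infinite (omega (F 0) 1).
Proof.
  intros [l Hl].
  assert (H : (length (map (fun s => fiter (F 0) s 1) (seq 0 (S (length l)))) <= length l)%nat).
  { apply NoDup_incl_length.
    - apply NoDup_map_NoDup_ForallPairs; [|apply seq_NoDup].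
      intros s t _ _. apply fiter_one_inj.
    - intros y Hy. apply in_map_iff in Hy. destruct Hy as (s & <- & _).
      apply Hl, omega_one. }
  rewrite length_map, length_seq in H. lia.
Qed.

Lemma omega_unique (x : R) :
  inI x -> set_infinite (omega (F 0) x) -> set_eq (omega (F 0) x) (omega (F 0) 1).
Proof.
  intros Hx Hinf.
  assert (Hs : solenoidal x).
  { apply NNPP. intro H. apply (omega_eventually_periodic_finite (F 0) x); [|exact Hinf].
    apply not_solenoidal_periodic; [now apply inI_inL | exact H]. }
  intro y. split; apply omega_solenoidal_subset; auto using solenoidal_one.
Qed.

(** * The associated system *)

Lemma J_0 (n k : nat) (x : R) : J n k 0 x <-> inL (n + k) x.
Proof.
  revert k. induction n as [|n IH]; intro k; [reflexivity|].
  change 0%Z with (2 * 0)%Z. rewrite J_even.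
  replace (S n + k)%nat with (n + S k)%nat by lia. apply IH.
Qed.

Lemma emb_not_low (k : nat) (y : R) : inL (S k) y -> ~ inL (S k) (emb k y).
Proof.
  intros H H'. apply emb_inL in H. pose proof (level_order k). unfold inL in H'. lra.
Qed.

Lemma U_low (n k : nat) (x : R) : inL (S k) x -> U (S n) k x -> U n (S k) x.
Proof.
  intros Hx H. apply U_S in H. destruct H as [H | (y & Hy & ->)]; [exact H|].
  exfalso. eapply emb_not_low, Hx. eapply U_inL, Hy.
Qed.

Lemma U_emb (n k : nat) (x : R) : inL (S k) x -> U (S n) k (emb k x) -> U n (S k) x.
Proof.
  intros Hx H. apply U_S in H. destruct H as [H | (y & Hy & Heq)].
  - exfalso. eapply emb_not_low; [exact Hx|]. eapply U_inL, H.
  - apply emb_inj in Heq. now subst.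
Qed.

Lemma inL_add (n k : nat) (x : R) : inL (n + k) x -> inL k x.
Proof. induction n as [|n IH]; [trivial|]. intro H. apply IH, inL_S, H. Qed.

Lemma U_descend (n m k : nat) (x : R) : inL (n + k) x -> U (n + m) k x -> U m (n + k) x.
Proof.
  revert k. induction n as [|n IH]; intros k Hx H; [exact H|].
  replace (S n + k)%nat with (n + S k)%nat in * by lia.
  apply IH; [exact Hx|]. apply U_low; [eapply inL_add, Hx | exact H].
Qed.

(* The orbit of [w] accumulates at [ell n], so the interval contains [R_n], whose
   image contains [0]. *)
Lemma absorb (n : nat) (c d w : R) :
  c <= w <= d -> (forall m, U m n w) ->
  (forall x, c <= x <= d -> inL n x -> c <= F n x <= d) ->
  forall x, inL n x -> c <= x <= d.
Proof.
  intros Hw HU Hinv.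
  assert (HwL : inL n w) by (eapply U_inL, (HU 0%nat)).
  assert (Horb : forall t, c <= fiter (F n) t w <= d).
  { induction t as [|t IH]; [exact Hw|]. apply Hinv; [exact IH | apply fiter_inL, HwL]. }
  assert (Hd : ell n <= d).
  { apply Rnot_lt_le. intro Hlt. destruct (inv_pow2_small (ell n - d)) as [m Hm]; [lra|].
    specialize (Hm m (le_n m)). destruct (J_top m n) as [j Hj].
    destruct (fiter_visits m n w j 0 (HU m)) as (t & _ & Ht). apply Hj in Ht.
    specialize (Horb t). lra. }
  assert (Hc : c <= ell (S n)).
  { destruct (fiter_visits 1 n w 0 0 (HU 1%nat)) as (t & _ & Ht).
    specialize (Horb t). apply J_0 in Ht. unfold inL in Ht. simpl in Ht. lra. }
  destruct (F_J_onto 1 n 1 0) as (v & Hv & Hv0).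
  { change (1 + 1)%Z with (2 * 1)%Z. rewrite J_even. apply inL_0. }
  change 1%Z with (2 * 0 + 1)%Z in Hv. rewrite J_odd in Hv.
  destruct Hv as (y & Hy & ->). apply J_inL in Hy. pose proof (level_order n).
  assert (Hv := emb_inL n y Hy).
  specialize (Hinv (emb n y) ltac:(lra) (inL_emb n y Hy)). rewrite Hv0 in Hinv.
  intros x Hx. unfold inL in Hx. lra.
Qed.

Lemma image_interval (f : R -> R) (c d : R) : continuity f -> c <= d ->
  exists c' d', c' <= d' /\ forall y, image f (cinterval c d) y <-> c' <= y <= d'.
Proof.
  intros Hf Hcd.
  destruct (continuity_ab_min f c d Hcd) as (mi & Hmi & Hmi'); [intros; apply Hf|].
  destruct (continuity_ab_maj f c d Hcd) as (ma & Hma & Hma'); [intros; apply Hf|].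
  exists (f mi), (f ma). split; [now apply Hma|]. intro y. split.
  - intros (x & Hx & <-). split; [apply Hmi | apply Hma]; exact Hx.
  - intro Hy. destruct (intermediate_value f mi ma y Hf Hy) as (x & Hx & Hx').
    exists x. split; [|exact Hx']. unfold cinterval. revert Hx.
    unfold Rmin, Rmax. destruct Rle_dec; lra.
Qed.

Lemma iter_image_interval (f : R -> R) (i : nat) (c d : R) : continuity f -> c <= d ->
  exists c' d', forall y, iter_image f i (cinterval c d) y <-> c' <= y <= d'.
Proof.
  intros Hf Hcd.
  cut (exists c' d', c' <= d' /\ forall y, iter_image f i (cinterval c d) y <-> c' <= y <= d').
  { intros (c' & d' & _ & H). eauto. }
  induction i as [|i (c1 & d1 & H1 & IH)].
  - exists c, d. split; [exact Hcd|]. intro y. split.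
    + now intros (x & Hx & <-).
    + intro Hy. now exists y.
  - destruct (image_interval f c1 d1 Hf H1) as (c2 & d2 & H2 & Hi). exists c2, d2.
    split; [exact H2|]. intro y. rewrite <- Hi. split.
    + intros (x & Hx & <-). exists (fiter f i x). split; [|reflexivity].
      apply IH. now exists x.
    + intros (z & Hz & <-). apply IH in Hz. destruct Hz as (x & Hx & <-). now exists x.
Qed.

Definition lo (n k : nat) : R := jmap n 0 (Z.of_nat k) 0.
Definition hi (n k : nat) : R := jmap n 0 (Z.of_nat k) (ell n).

Lemma cinterval_J (n k : nat) (x : R) :
  cinterval (lo n k) (hi n k) x <-> J n 0 (Z.of_nat k) x.
Proof. rewrite J_interval, Nat.add_0_r. reflexivity. Qed.

Lemma lo_hi_bounds (n k : nat) : 0 <= lo n k <= hi n k /\ hi n k <= 1.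
Proof.
  assert (H : lo n k <= hi n k).
  { apply jmap_le. pose proof (half_lt_ell n). lra. }
  assert (Hlo : inL 0 (lo n k)).
  { apply (J_inL n 0 (Z.of_nat k)), cinterval_J. unfold cinterval. lra. }
  assert (Hhi : inL 0 (hi n k)).
  { apply (J_inL n 0 (Z.of_nat k)), cinterval_J. unfold cinterval. lra. }
  unfold inL in *. rewrite ell_0 in *. lra.
Qed.

Lemma iter_image_J (n k t : nat) (y : R) :
  iter_image (F 0) t (cinterval (lo n k) (hi n k)) y <-> J n 0 (Z.of_nat k + Z.of_nat t) y.
Proof.
  split.
  - intros (x & Hx & <-). apply fiter_J. now apply cinterval_J.
  - intro H. apply fiter_J_onto in H. destruct H as (x & Hx & <-).
    exists x. split; [now apply cinterval_J | reflexivity].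
Qed.

Lemma pow2_Z (n : nat) : Z.of_nat (2 ^ n) = (2 ^ Z.of_nat n)%Z.
Proof. apply (Nat2Z.inj_pow 2 n). Qed.

Lemma divides_small (n : nat) (z : Z) :
  (2 ^ Z.of_nat n | z)%Z -> (Z.abs z < Z.of_nat (2 ^ n))%Z -> z = 0%Z.
Proof.
  intros Hd Hz. rewrite pow2_Z in Hz. apply NNPP. intro Hne.
  apply Z.divide_abs_r in Hd. apply Z.divide_pos_le in Hd; lia.
Qed.

Lemma J_periodic_cover (n k : nat) :
  periodic_interval_cover (F 0) (lo n k) (hi n k) (2 ^ n) (omega (F 0) 1).
Proof.
  pose proof (lo_hi_bounds n k) as Hb.
  split; [lra|]. split; [lra|]. split; [|split].
  - intro x. rewrite iter_image_J, cinterval_J.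
    split; apply J_congr; rewrite pow2_Z; [exists 1%Z | exists (-1)%Z]; ring.
  - intros i j Hi Hj Hij x Hx Hx'. rewrite iter_image_J in Hx, Hx'.
    assert (Hd := J_disjoint _ _ _ _ _ Hx Hx'). apply divides_small in Hd; lia.
  - intros x Hx. destruct (omega_one_U n x Hx) as [j Hj].
    pose proof (Z.mod_pos_bound (j - Z.of_nat k) (2 ^ Z.of_nat n)) as Hm.
    assert (Hp : (0 < 2 ^ Z.of_nat n)%Z) by (apply Z.pow_pos_nonneg; lia).
    specialize (Hm Hp).
    exists (Z.to_nat ((j - Z.of_nat k) mod 2 ^ Z.of_nat n)). split.
    + apply Nat2Z.inj_lt. rewrite pow2_Z, Z2Nat.id by lia. lia.
    + apply iter_image_J. rewrite Z2Nat.id by lia. eapply J_congr; [|exact Hj].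
      exists ((j - Z.of_nat k) / 2 ^ Z.of_nat n)%Z.
      pose proof (Z.div_mod (j - Z.of_nat k) (2 ^ Z.of_nat n)). lia.
Qed.

(** On [L_n] the iterate of order [2 ^ n] is [F n], so [absorb] applies. *)
Lemma invariant_interval_contains_L (n : nat) (c d w : R) (t : nat) :
  w = fiter (F 0) t 1 -> inL n w -> c <= w <= d ->
  (forall x, c <= x <= d -> c <= fiter (F 0) (2 ^ n) x <= d) ->
  forall x, inL n x -> c <= x <= d.
Proof.
  intros -> HL Hw Hinv. apply (absorb n c d _ Hw).
  - intro m. rewrite <- (Nat.add_0_r n). apply U_descend; [|apply U_one].
    now rewrite Nat.add_0_r.
  - intros x Hx HxL. assert (HF := fiter_pow2 n 0 x).
    rewrite Nat.add_0_r in HF. rewrite <- (HF HxL). now apply Hinv.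
Qed.

(** Some iterate of [[c, d]] meets the orbit of 1 inside [L_n]; being an interval invariant under
    the iterate of order [2 ^ n], it contains all of [L_n]. The remaining iterates of the period
    carry [L_n] onto the given interval and return to [[c, d]]. *)
Lemma J_minimal (n k : nat) (c d : R) : (k < 2 ^ n)%nat ->
  subset (cinterval c d) (cinterval (lo n k) (hi n k)) ->
  periodic_interval_cover (F 0) c d (2 ^ n) (omega (F 0) 1) ->
  c = lo n k /\ d = hi n k.
Proof.
  intros Hk Hsub (Hcd & Hd1 & Hper & _ & Hcov).
  destruct (fiter_visits n 0 1 0 0 (U_one n 0)) as (t & _ & Hw).
  set (w := fiter (F 0) t 1) in *.
  destruct (Hcov w (omega_one t)) as (i & Hi & Hwi).
  assert (Hdiv : (2 ^ Z.of_nat n | Z.of_nat k + Z.of_nat i - 0)%Z).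
  { eapply J_disjoint; [|exact Hw]. destruct Hwi as (x & Hx & <-).
    apply fiter_J, cinterval_J, Hsub, Hx. }
  destruct (iter_image_interval (F 0) i c d (continuity_F 0) ltac:(lra)) as (c' & d' & Hcd').
  assert (HL : forall x, inL n x -> c' <= x <= d').
  { apply (invariant_interval_contains_L n c' d' w t).
    - reflexivity.
    - apply J_0 in Hw. now rewrite Nat.add_0_r in Hw.
    - now apply Hcd'.
    - intros y Hy. apply Hcd' in Hy. destruct Hy as (x & Hx & <-). apply Hcd'.
      exists (fiter (F 0) (2 ^ n) x). split; [apply Hper; now exists x|].
      rewrite <- !fiter_add. f_equal. lia. }
  assert (Hsup : subset (cinterval (lo n k) (hi n k)) (cinterval c d)).
  { intros y Hy. apply cinterval_J in Hy.
    assert (Hy' : J n 0 (Z.of_nat k + Z.of_nat i + Z.of_nat (2 ^ n - i)) y).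
    { eapply J_congr; [|exact Hy]. exists (-1)%Z.
      rewrite Nat2Z.inj_sub, pow2_Z by lia. ring. }
    apply fiter_J_onto in Hy'. destruct Hy' as (z & Hz & <-).
    assert (HzL : inL n z).
    { rewrite <- (Nat.add_0_r n). apply J_0. eapply J_congr; eauto. }
    apply HL, Hcd' in HzL. destruct HzL as (x & Hx & <-).
    apply Hper. exists x. split; [exact Hx|].
    rewrite <- fiter_add. f_equal. lia. }
  pose proof (lo_hi_bounds n k) as Hb.
  destruct (Hsub c ltac:(unfold cinterval; lra)).
  destruct (Hsub d ltac:(unfold cinterval; lra)).
  destruct (Hsup (lo n k) ltac:(unfold cinterval; lra)).
  destruct (Hsup (hi n k) ltac:(unfold cinterval; lra)). lra.
Qed.

Lemma mod_succ_divides (n k : nat) :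
  (2 ^ Z.of_nat n | Z.of_nat k + 1 - Z.of_nat ((k + 1) mod 2 ^ n))%Z.
Proof.
  exists (Z.of_nat ((k + 1) / 2 ^ n)). rewrite <- pow2_Z.
  pose proof (Nat.div_mod (k + 1) (2 ^ n) ltac:(apply Nat.pow_nonzero; lia)) as H. nia.
Qed.

Lemma J_assoc_system : assoc_system (F 0) (omega (F 0) 1) lo hi.
Proof.
  split; [intros; apply lo_hi_bounds|]. split; [|split; [|split; [|split]]].
  - intros n k Hk y. rewrite cinterval_J. pose proof (mod_succ_divides n k) as Hm.
    split.
    + intros (x & Hx & <-). apply cinterval_J in Hx. eapply J_congr; [exact Hm|].
      apply F_J, Hx.
    + intro Hy. destruct (F_J_onto n 0 (Z.of_nat k) y) as (x & Hx & Hxy).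
      { eapply J_congr; [|exact Hy]. apply Z.divide_opp_r.
        now rewrite Z.opp_sub_distr, Z.add_comm, Z.add_opp_r. }
      exists x. split; [now apply cinterval_J | exact Hxy].
  - intros n k k' Hk Hk' Hne x Hx Hx'. rewrite cinterval_J in Hx, Hx'.
    assert (Hd := J_disjoint _ _ _ _ _ Hx Hx'). apply divides_small in Hd; lia.
  - intros n x Hx. destruct (J_periodic_cover n 0) as (_ & _ & _ & _ & Hc).
    destruct (Hc x Hx) as (i & Hi & Hxi). exists i. split; [exact Hi|].
    apply cinterval_J. now apply iter_image_J in Hxi.
  - intros n k Hk c d. now apply J_minimal.
  - intros n x Hx. apply cinterval_J in Hx. apply cinterval_J. now apply J_nested.
Qed.

(** * Uniqueness of the associated system up to its numbering *)

Lemma assoc_system_orbit (f : R -> R) (W : R -> Prop) (a b : nat -> nat -> R) :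
  assoc_system f W a b -> forall n k t x, (k < 2 ^ n)%nat ->
  cinterval (a n k) (b n k) x ->
  cinterval (a n ((k + t) mod 2 ^ n)%nat) (b n ((k + t) mod 2 ^ n)%nat) (fiter f t x).
Proof.
  intros (_ & Him & _) n k t x Hk Hx. induction t as [|t IH].
  - rewrite Nat.add_0_r, Nat.mod_small by exact Hk. exact Hx.
  - assert (H2 : (2 ^ n <> 0)%nat) by (apply Nat.pow_nonzero; lia).
    replace ((k + S t) mod 2 ^ n)%nat with (((k + t) mod 2 ^ n + 1) mod 2 ^ n)%nat.
    + apply (Him n); [apply Nat.mod_upper_bound; exact H2|]. now exists (fiter f t x).
    + rewrite Nat.Div0.add_mod_idemp_l. f_equal. lia.
Qed.

(** The numbering of a system is only determined up to a cyclic shift [k0] at each level. The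
    interval numbered [k0] contains [L_n] by absorption, so each interval contains one of the cycle
    of [L_n], and minimality in the given system forces equality. *)
Lemma assoc_system_unique (a b : nat -> nat -> R) (n : nat) :
  assoc_system (F 0) (omega (F 0) 1) a b ->
  exists k0, (k0 < 2 ^ n)%nat /\ forall i,
    a n ((k0 + i) mod 2 ^ n)%nat = lo n i /\ b n ((k0 + i) mod 2 ^ n)%nat = hi n i.
Proof.
  intro Has. assert (Horb := assoc_system_orbit _ _ _ _ Has n).
  destruct Has as (_ & _ & _ & Hcov & Hmin & _).
  destruct (fiter_visits n 0 1 0 0 (U_one n 0)) as (t & _ & Hw).
  destruct (Hcov n _ (omega_one t)) as (k0 & Hk0 & Hwk). exists k0.
  split; [exact Hk0|]. intro i.
  assert (H2 : (2 ^ n <> 0)%nat) by (apply Nat.pow_nonzero; lia).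
  assert (HL : forall x, inL n x -> a n k0 <= x <= b n k0).
  { apply (invariant_interval_contains_L n _ _ _ t eq_refl).
    - apply J_0 in Hw. now rewrite Nat.add_0_r in Hw.
    - exact Hwk.
    - intros x Hx. specialize (Horb k0 (2 ^ n)%nat x Hk0 Hx).
      replace ((k0 + 2 ^ n) mod 2 ^ n)%nat with k0 in Horb; [exact Horb|].
      rewrite <- (Nat.mul_1_l (2 ^ n)) at 1. rewrite Nat.Div0.mod_add.
      now rewrite Nat.mod_small. }
  destruct (Hmin n ((k0 + i) mod 2 ^ n)%nat (Nat.mod_upper_bound _ _ H2) (lo n i) (hi n i))
    as [H H']; [|apply J_periodic_cover | now split].
  intros y Hy. apply cinterval_J in Hy.
  change (Z.of_nat i) with (0 + Z.of_nat i)%Z in Hy. apply fiter_J_onto in Hy.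
  destruct Hy as (x & Hx & <-). apply Horb; [exact Hk0|]. apply HL.
  rewrite <- (Nat.add_0_r n). now apply J_0.
Qed.

Lemma simple_set_unique (a b : nat -> nat -> R) :
  assoc_system (F 0) (omega (F 0) 1) a b ->
  forall x, simple_set a b x <-> forall n, U n 0 x.
Proof.
  intros Has x. split; intros H n; specialize (H n);
    destruct (assoc_system_unique a b n Has) as (k0 & Hk0 & Hab).
  - destruct H as (k & Hk & Hx). exists (Z.of_nat (k + (2 ^ n - k0))).
    apply cinterval_J. destruct (Hab (k + (2 ^ n - k0))%nat) as [<- <-].
    replace ((k0 + (k + (2 ^ n - k0))) mod 2 ^ n)%nat with k; [exact Hx|].
    replace (k0 + (k + (2 ^ n - k0)))%nat with (k + 1 * 2 ^ n)%nat by lia.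
    rewrite Nat.Div0.mod_add. now rewrite Nat.mod_small.
  - destruct H as [j Hj]. destruct (visit n 0 j 0) as (i & _ & Hi).
    exists ((k0 + i) mod 2 ^ n)%nat. split.
    { apply Nat.mod_upper_bound, Nat.pow_nonzero. lia. }
    destruct (Hab i) as [-> ->]. apply cinterval_J. eapply J_congr; [|exact Hj].
    apply Z.divide_opp_r. now replace (- (j - Z.of_nat i))%Z with (0 + Z.of_nat i - j)%Z by ring.
Qed.

(** * Components of the simple set *)

Definition M (k : nat) (x : R) : Prop := forall n, U n k x.
Definition G (k : nat) (j : Z) (x : R) : Prop := forall n, J n k j x.

(* Sufficient for [n] negabinary digits to represent [j] at level [k]. *)
Definition small (n k : nat) (j : Z) : Prop :=
  let s := if Nat.even k then j else (- j)%Z in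
  (2 * s <= Z.of_nat n /\ 1 - 2 * s <= Z.of_nat n)%Z.

Lemma even_S (k : nat) : Nat.even (S k) = negb (Nat.even k).
Proof. rewrite Nat.even_succ. symmetry. apply Nat.negb_even. Qed.

(** For [i = 0] the number of required digits does not decrease; that case is left to [jmap_0]. *)
Lemma small_even (n k : nat) (i : Z) : i <> 0%Z -> small (S n) k (2 * i) -> small n (S k) i.
Proof. unfold small. rewrite even_S. destruct (Nat.even k); cbn [negb]; lia. Qed.

Lemma small_odd (n k : nat) (i : Z) :
  small (S n) k (2 * i + 1) -> small n (S k) (i + par k).
Proof. unfold small, par. rewrite even_S. destruct (Nat.even k); cbn [negb]; lia. Qed.

Lemma small_0 (k : nat) (j : Z) : ~ small 0 k j.
Proof. unfold small. destruct (Nat.even k); lia. Qed.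

Lemma small_large (k : nat) (j : Z) (n : nat) :
  (2 * Z.abs_nat j + 1 <= n)%nat -> small n k j.
Proof. unfold small. destruct (Nat.even k); lia. Qed.

Lemma jmap_0 (n k : nat) (y : R) : jmap n k 0 y = y.
Proof. revert k. induction n as [|n IH]; intro k; [reflexivity|]. apply (IH (S k)). Qed.

(** When [n] digits represent [j], the next negabinary digit is 0, that is, the choice L, which does
    not change the parametrization. *)
Lemma jmap_stable_S (n k : nat) (j : Z) (y : R) :
  small n k j -> jmap (S n) k j y = jmap n k j y.
Proof.
  revert k j. induction n as [|n IH]; intros k j H; [now apply small_0 in H|].
  destruct (Z_even_or_odd j) as [i [-> | ->]].
  - rewrite (jmap_even (S n)), (jmap_even n). destruct (Z.eq_dec i 0) as [->|Hi].
    + now rewrite !jmap_0.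
    + apply IH, small_even; assumption.
  - rewrite (jmap_odd (S n)), (jmap_odd n). f_equal. apply IH, small_odd, H.
Qed.

Lemma jmap_stable (m n k : nat) (j : Z) (y : R) :
  small n k j -> jmap (m + n) k j y = jmap n k j y.
Proof.
  intro H. induction m as [|m IH]; [reflexivity|].
  rewrite <- IH. apply jmap_stable_S. unfold small in *. destruct (Nat.even k); lia.
Qed.

Lemma jmap_J (n k : nat) (j : Z) (y : R) : inL (n + k) y -> J n k j (jmap n k j y).
Proof. intros [H0 H1]. apply J_interval. split; now apply jmap_le. Qed.

Lemma jmap_inL (m k : nat) (i : Z) (y : R) :
  inL (S m + k) y -> inL (S k) (jmap m (S k) i y).
Proof.
  intro H. eapply J_inL, jmap_J. now replace (m + S k)%nat with (S m + k)%nat by lia.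
Qed.

(* [F k] fails to be affine only near the 2-adic integer [-1/3] ([k] even) or
   [-2/3] ([k] odd). *)
Lemma F_jmap (n k : nat) (j : Z) (y : R) :
  j = 0%Z \/ small n k j -> inL (S (S n) + k) y ->
  F k (jmap (S (S n)) k j y) = jmap (S (S n)) k (j + 1) y.
Proof.
  revert k j. induction n as [|n IH]; intros k j Hs Hy;
    assert (Hin := fun i => jmap_inL _ k i y Hy);
    (destruct (Z_even_or_odd j) as [i [-> | ->]];
     [ rewrite jmap_even, jmap_odd, F_low by apply Hin; f_equal; unfold al
     | replace (2 * i + 1 + 1)%Z with (2 * (i + 1))%Z by ring;
       rewrite jmap_even, jmap_odd, F_emb by apply Hin; unfold be ]);
    destruct (par_cases k) as [[Hk Hp]|[Hk Hp]]; rewrite Hk, Hp, ?Z.add_0_r;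
    try reflexivity.
  - assert (i = 0%Z) as ->.
    { destruct Hs as [Hs|Hs]; [lia | now apply small_0 in Hs]. }
    rewrite F_low by (rewrite jmap_0; exact Hy).
    unfold al. rewrite even_S, Hk. cbn [negb].
    change (0 + 1)%Z with (2 * 0 + 1)%Z. rewrite jmap_odd. unfold par.
    rewrite even_S, Hk. cbn [negb]. now rewrite Z.add_0_l, !jmap_0.
  - destruct Hs as [Hs|Hs]; [lia | now apply small_0 in Hs].
  - apply IH; [|now replace (S (S n) + S k)%nat with (S (S (S n)) + k)%nat by lia].
    destruct (Z.eq_dec i 0) as [Hi|Hi]; [now left | right].
    destruct Hs as [Hs|Hs]; [lia|]. now apply small_even in Hs.
  - apply IH; [|now replace (S (S n) + S k)%nat with (S (S (S n)) + k)%nat by lia].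
    right. destruct Hs as [Hs|Hs]; [lia|]. apply small_odd in Hs.
    now rewrite Hp, Z.add_0_r in Hs.
Qed.

(** With stable parametrizations the deeper intervals are the images of [[0, ell (m + n + k)]] under
    one affine map, and these shrink to the image of [[0, 1/2]]. *)
Lemma G_core (n k : nat) (j : Z) (x : R) : small n k j -> G k j x <-> core n k j x.
Proof.
  intro Hs. split; intro H.
  - assert (Hm : forall m, jmap n k j 0 <= x <= jmap n k j (ell (m + n + k))).
    { intro m. rewrite <- !(jmap_stable m n k j) by exact Hs. apply J_interval, H. }
    split; [apply (Hm 0%nat)|]. apply Rnot_lt_le. intro Hlt.
    destruct (jmap_affine n k j) as (s & Hs1 & Ha).
    destruct (inv_pow2_small (x - jmap n k j (/ 2))) as [m Hm']; [lra|].
    specialize (Hm' (m + n + k)%nat ltac:(lia)). specialize (Hm m).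
    specialize (Ha (ell (m + n + k)) (/ 2)).
    pose proof (inv_pow2_bounds (m + n + k)).
    replace (ell (m + n + k) - / 2) with (/ 2 ^ (m + n + k) / 2) in Ha by (unfold ell; lra).
    nra.
  - intro m. assert (Hmn : J (m + n) k j x).
    { apply core_sub_J. unfold core. now rewrite !jmap_stable. }
    clear - Hmn. induction n as [|n IH].
    + now rewrite Nat.add_0_r in Hmn.
    + apply IH, J_nested. now rewrite Nat.add_succ_r in Hmn.
Qed.

Lemma G_nondegenerate (k : nat) (j : Z) : nondegenerate (G k j).
Proof.
  set (n := (2 * Z.abs_nat j + 1)%nat).
  assert (Hs : small n k j) by (apply small_large; unfold n; lia).
  destruct (jmap_affine n k j) as (s & Hs1 & Ha). specialize (Ha (/ 2) 0).
  exists (jmap n k j 0), (jmap n k j (/ 2)).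
  rewrite !(G_core n) by exact Hs. unfold core. repeat split; nra.
Qed.

Lemma F_G (k : nat) (j : Z) : set_eq (image (F k) (G k j)) (G k (j + 1)).
Proof.
  intro y. split.
  - intros (x & Hx & <-) n. apply F_J, Hx.
  (* Large enough for the digits of both [j] and [j + 1]. *)
  - intro Hy. set (n := (2 * Z.abs_nat j + 3)%nat).
    assert (Hs : small n k j) by (apply small_large; unfold n; lia).
    assert (Hs1 : small (S (S n)) k j) by (apply small_large; unfold n; lia).
    assert (Hs2 : small (S (S n)) k (j + 1)) by (apply small_large; unfold n; lia).
    apply (G_core _ _ _ _ Hs2) in Hy. unfold core in Hy.
    destruct (jmap_affine (S (S n)) k (j + 1)) as (s & Hp & Ha).
    (* The parameter of [y]; by [F_jmap] the point with the same parameter over [j] is a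
       preimage. *)
    set (z := (y - jmap (S (S n)) k (j + 1) 0) / s).
    assert (Hz : y = jmap (S (S n)) k (j + 1) z).
    { specialize (Ha z 0). unfold z in Ha at 2.
      replace (s * ((y - jmap (S (S n)) k (j + 1) 0) / s - 0))
        with (y - jmap (S (S n)) k (j + 1) 0) in Ha by (field; lra). lra. }
    assert (Hz2 : 0 <= z <= / 2).
    { rewrite Hz in Hy. pose proof (Ha z 0). pose proof (Ha (/ 2) z). split; nra. }
    exists (jmap (S (S n)) k j z). split.
    + apply (G_core _ _ _ _ Hs1). split; apply jmap_le; lra.
    + rewrite F_jmap; [now symmetry | now right|].
      pose proof (half_lt_ell (S (S n) + k)). unfold inL. lra.
Qed.

Lemma G_disjoint (k : nat) (j j' : Z) (x : R) : G k j x -> G k j' x -> j = j'.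
Proof.
  intros H H'. apply NNPP. intro Hne.
  destruct (no_large_pow2_divides (j - j')) as [n Hn]; [lia|].
  apply Hn. eapply J_disjoint; [apply H | apply H'].
Qed.

Lemma G_even (k : nat) (i : Z) (x : R) : G (S k) i x -> G k (2 * i) x.
Proof. intros H [|n]; [apply inL_S, (H 0%nat)|]. rewrite J_even. apply H. Qed.

Lemma G_odd (k : nat) (i : Z) (x : R) : G (S k) i x -> G k (2 * (i - par k) + 1) (emb k x).
Proof.
  intros H [|n]; [apply inL_emb, (H 0%nat)|]. rewrite J_odd. exists x.
  split; [|reflexivity]. replace (i - par k + par k)%Z with i by ring. apply H.
Qed.

Lemma M_inL (k : nat) (x : R) : M k x -> inL k x.
Proof. intro H. eapply U_inL, (H 0%nat). Qed.

Lemma M_S (k : nat) (x : R) :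
  M k x -> (inL (S k) x /\ M (S k) x) \/
           exists y, x = emb k y /\ inL (S k) y /\ M (S k) y.
Proof.
  intro H. destruct (proj1 (U_S 0 k x) (H 1%nat)) as [H1 | (y & Hy & ->)].
  - apply U_inL in H1. left. split; [exact H1|]. intro n. apply U_low; auto.
  - apply U_inL in Hy. right. exists y. split; [reflexivity|]. split; [exact Hy|].
    intro n. apply U_emb; auto.
Qed.

(** A segment in [M k] cannot cross the gap, so it lies wholly on the left or on the right and
    passes to level [S k]. *)
Lemma M_interval_S (k : nat) (x y : R) :
  x < y -> (forall z, x <= z <= y -> M k z) ->
  (forall z, x <= z <= y -> M (S k) z) \/
  exists x' y', x = emb k x' /\ y = emb k y' /\ forall z, x' <= z <= y' -> M (S k) z.
Proof.
  intros Hxy H. pose proof (level_order k).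
  destruct (M_S k y (H y ltac:(lra))) as [[Hy _] | (y' & -> & Hy & _)].
  - left. intros z Hz. destruct (M_S k z (H z Hz)) as [[_ H1] | (z' & -> & Hz' & _)]; [exact H1|].
    exfalso. apply emb_inL in Hz'. unfold inL in Hy. lra.
  - right. destruct (M_S k x (H x ltac:(lra))) as [[Hx _] | (x' & -> & Hx & _)].
    + exfalso. apply emb_inL in Hy. unfold inL in Hx.
      destruct (M_S k ((ell (S k) + emb k 0) / 2)) as [[Hz _] | (z & Hz & Hz' & _)].
      * apply H. lra.
      * unfold inL in Hz. lra.
      * apply emb_inL in Hz'. lra.
    + exists x', y'. split; [reflexivity|]. split; [reflexivity|]. intros z Hz.
      destruct (M_S k (emb k z)) as [[Hl _] | (z' & Heq & _ & Hz')].
      * apply H. split; apply emb_le; lra.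
      * exfalso. apply (emb_not_low k z); [unfold inL in *; lra | exact Hl].
      * apply emb_inj in Heq. now subst.
Qed.

(* Each passage to a right interval stretches the segment by at least 8. *)
Lemma M_interval_G (r k : nat) (x y : R) :
  x < y -> / 2 ^ r <= y - x -> (forall z, x <= z <= y -> M k z) ->
  exists j, G k j x /\ G k j y.
Proof.
  revert k x y. induction r as [|r IHr]; intros k x y Hxy Hr H.
  (* If [y] lies in every [L_m], so does the segment, and the index is 0. Otherwise an inner
     induction on [m] runs through the left choices that precede the first passage to the right. *)
  all: destruct (classic (forall m, inL (m + k) y)) as [Hy|Hy];
    [ exists 0%Z; split; intro n; apply J_0; [|apply Hy];
      specialize (Hy n); pose proof (M_inL k x (H x ltac:(lra))); unfold inL in *; lra |].
  all: apply not_all_ex_not in Hy; destruct Hy as [m Hm];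
    revert k H Hm; induction m as [|m IHm]; intros k H Hm;
    [ exfalso; apply Hm, M_inL, H; lra |];
    destruct (M_interval_S k x y Hxy H) as [H' | (x' & y' & -> & -> & H')];
    [ destruct (IHm (S k) H') as (j & Hjx & Hjy);
      [ now replace (m + S k)%nat with (S m + k)%nat by lia
      | exists (2 * j)%Z; split; now apply G_even ] |].
  all: pose proof (scale_bounds k); rewrite emb_sub in Hr.
  all: assert (Hlt : x' < y') by
    (apply Rnot_le_lt; intro Hle; apply (emb_le k) in Hle; lra).
  (* A segment of length at least 1 would be stretched to length at least 8 inside the unit
     interval. *)
  - exfalso. simpl in Hr.
    pose proof (inL_unit (S k) x' (M_inL (S k) x' (H' x' ltac:(lra)))).
    pose proof (inL_unit (S k) y' (M_inL (S k) y' (H' y' ltac:(lra)))). nra.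
  - rewrite inv_pow2_S in Hr.
    destruct (IHr (S k) x' y' Hlt) as (j & Hjx & Hjy); [nra | exact H' |].
    exists (2 * (j - par k) + 1)%Z. split; now apply G_odd.
Qed.

Lemma M_segment (x y : R) :
  x < y -> (forall z, x <= z <= y -> M 0 z) -> exists j, G 0 j x /\ G 0 j y.
Proof.
  intros Hxy H. destruct (inv_pow2_small (y - x)) as [r Hr]; [lra|].
  specialize (Hr r (le_n r)). apply (M_interval_G r 0 x y Hxy); [lra | exact H].
Qed.

(** Any further point of [C] spans with [x] or [y] a segment in the simple set. The segment lies in
    one [G 0 j'], and the common end point forces [j' = j]. *)
Lemma convex_in_G (C : R -> Prop) (j : Z) (x y : R) :
  convex C -> subset C (M 0) -> C x -> C y -> x < y -> G 0 j x -> G 0 j y -> subset C (G 0 j).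
Proof.
  intros Hc Hs Cx Cy Hxy Gx Gy z Cz. destruct (Rle_dec z x) as [Hz|Hz].
  - destruct (M_segment z y ltac:(lra)) as (j' & H1 & H2).
    + intros v Hv. apply Hs. exact (Hc z y v Cz Cy Hv).
    + now rewrite (G_disjoint 0 j j' y Gy H2).
  - destruct (M_segment x z ltac:(lra)) as (j' & H1 & H2).
    + intros v Hv. apply Hs. exact (Hc x z v Cx Cz Hv).
    + now rewrite (G_disjoint 0 j j' x Gx H1).
Qed.

Lemma G_convex (k : nat) (j : Z) : convex (G k j).
Proof.
  intros x y z Hx Hy Hz n. specialize (Hx n). specialize (Hy n).
  rewrite J_interval in *. lra.
Qed.

Lemma G_sub_M (k : nat) (j : Z) : subset (G k j) (M k).
Proof. intros x Hx n. exists j. apply Hx. Qed.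

(** Stated for any set with the same points as [M 0], since the simple set of an arbitrary
    associated system is known only up to this equivalence. *)
Lemma M_simple_set_props (S : R -> Prop) :
  (forall x, S x <-> M 0 x) -> simple_set_props (F 0) S.
Proof.
  intro HS. split.
  - destruct (G_nondegenerate 0 0) as (u & v & Gu & Gv & Huv). exists u, v.
    split; [exact Huv|]. intros x Hx. apply HS, (G_sub_M 0 0).
    apply (G_convex 0 0 u v); auto. lra.
  - exists (G 0). split; [|split; [|split]].
    + intro n. split; [|apply G_nondegenerate].
      destruct (G_nondegenerate 0 n) as (u & v & Gu & Gv & Huv).
      split; [now exists u|]. split; [apply G_convex|]. split.
      * intros x Hx. apply HS, (G_sub_M 0 n), Hx.
      * intros C HC HGC HCS x. split; [|apply HGC].
        apply (convex_in_G C n u v); auto. intros z Hz. apply HS, HCS, Hz.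
    + intros n m Heq. destruct (G_nondegenerate 0 n) as (u & _ & Gu & _).
      apply (G_disjoint 0 n m u Gu), Heq, Gu.
    + intros C (_ & HC & HCS & Hmax) (x & y & Cx & Cy & Hxy).
      assert (HCM : subset C (M 0)) by (intros z Hz; apply HS, HCS, Hz).
      destruct (M_segment x y Hxy) as (j & Gx & Gy).
      { intros z Hz. apply HCM. exact (HC x y z Cx Cy Hz). }
      exists j. assert (Hj : set_eq (G 0 j) C).
      { apply Hmax; [apply G_convex | now apply (convex_in_G C j x y) |].
        intros z Hz. apply HS, (G_sub_M 0 j), Hz. }
      intro z. symmetry. apply Hj.
    + intro n. apply F_G.
Qed.

(** * The properties of [F 0] combined *)

Lemma continuous_on_I_of_continuity (f : R -> R) : continuity f -> continuous_on_I f.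
Proof.
  intros Hf x _ e He. destruct (Hf x e He) as (d & Hd & H). exists d. split; [exact Hd|].
  intros y _ Hy. destruct (Req_dec y x) as [->|Hne].
  - rewrite Rminus_diag, Rabs_R0. exact He.
  - apply (H y). split; [|exact Hy]. split; [exact I | intro; now apply Hne].
Qed.

Theorem mainTheorem3 :
  exists f : R -> R,
    continuous_on_I f /\ maps_I_onto_I f /\
    (* (i) exactly one infinite omega-limit set, and h(f) = 0 *)
    (exists x0, inI x0 /\ set_infinite (omega f x0) /\
       (forall x, inI x -> set_infinite (omega f x) -> set_eq (omega f x) (omega f x0)) /\
       zero_entropy f /\
       (* (ii) *)
       ~ li_yorke_chaotic f /\
       (* the associated system exists, and for it (iii) and (iv) hold *)
       (exists a b, assoc_system f (omega f x0) a b) /\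
       (forall a b, assoc_system f (omega f x0) a b ->
          simple_set_props f (simple_set a b))).
Proof.
  exists (F 0). split; [apply continuous_on_I_of_continuity, continuity_F|]. split.
  { split.
    - intros x _. apply inI_inL, F_inL.
    - intros y Hy. apply inI_inL, F_onto in Hy. destruct Hy as (x & Hx & Hxy).
      exists x. split; [now apply inI_inL | exact Hxy]. }
  exists 1. split; [unfold inI; lra|]. split; [apply omega_one_infinite|].
  split; [apply omega_unique|]. split; [apply F_zero_entropy|].
  split; [apply F_not_li_yorke|]. split.
  - exists lo, hi. apply J_assoc_system.
  - intros a b Hab. apply M_simple_set_props, simple_set_unique, Hab.
Qed.
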